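(* Let $\Omega$ be a compact metric space, $T:\Omega\to\Omega$ a homeomorphism, $a\in C(\Omega,\mathbb C)$ and $b\in C(\Omega,\mathbb R)$, with associated Jacobi operators $J_\omega$ ($\omega\in\Omega$) and Jacobi cocycle maps $B^E:\Omega\to\mathrm M(2,\mathbb C)$. Let $E\in\mathbb C$. If $(T,B^E)$ has dominated splitting, then $E\in\bigcap_{\omega\in\Omega}\rho(J_\omega)$, where $\rho(J_\omega)=\mathbb C\setminus\sigma(J_\omega)$.
   Context: For $\omega\in\Omega$, $J_\omega:\ell^2(\mathbb Z)\to\ell^2(\mathbb Z)$ is $(J_\omega\psi)(n)=\overline{a(T^{n-1}\omega)}\psi(n-1)+a(T^n\omega)\psi(n+1)+b(T^n\omega)\psi(n)$. The Jacobi cocycle map is $B^E(\omega)=\begin{pmatrix}E-b(\omega)&-\overline{a(T^{-1}\omega)}\\ a(\omega)&0\end{pmatrix}$. Points of $\mathbb C\mathbb P^1=\mathbb C\cup\{\infty\}$ are identified with one-dimensional subspaces of $\mathbb C^2$: $z\in\mathbb C$ with $\mathrm{span}\{\binom1z\}$ and $\infty$ with $\mathrm{span}\{\binom01\}$. For $B\in C(\Omega,\mathrm M(2,\mathbb C))$ and $n\ge1$ put $B_n(\omega)=B(T^{n-1}\omega)\cdots B(\omega)$. Definition. $(T,B)$ has dominated splitting if there are two maps $E^s,E^u:\Omega\to\mathbb C\mathbb P^1$ such that: (1) $E^s,E^u$ are continuous; (2) $B(\omega)[E^s(\omega)]\subseteq E^s(T\omega)$ and $B(\omega)[E^u(\omega)]\subseteq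 E^u(T\omega)$ for all $\omega\in\Omega$; (3) there are a positive integer $N$ and $\lambda>1$ such that $\|B_N(\omega)\vec u\|>\lambda\|B_N(\omega)\vec s\|$ for all $\omega\in\Omega$ and all unit vectors $\vec u\in E^u(\omega)$, $\vec s\in E^s(\omega)$. *)

(* Defs.v *)
(* The complex numbers are R[i], for R : realType. *)
From HB Require Import structures.
From mathcomp Require Import all_boot all_order all_algebra.
From mathcomp Require Import complex.
From mathcomp Require Import all_classical all_reals all_analysis.
From mathcomp Require Import ring lra.

Set Implicit Arguments.
Unset Strict Implicit.
Unset Printing Implicit Defensive.

Import Order.TTheory GRing.Theory Num.Theory.
Import numFieldNormedType.Exports.
Import Normc.

Local Open Scope classical_set_scope.
Local Open Scope complex_scope.
Local Open Scope ring_scope.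

(* R[i]^o is R[i] as a normed module over itself; R[i] alone has no canonical
   topology. *)
Notation Cplx R := (R[i]^o).

Definition sumsq (R : realType) (psi : int -> Cplx R) : \bar R :=
  (\esum_(n in [set: int]) ((normc (psi n)) ^+ 2)%:E)%E.

Definition square_summable (R : realType) : {pred (int -> Cplx R)} :=
  fun psi => (sumsq psi < +oo)%E.

Section Ell2.
Variable R : realType.
Implicit Types (x y : int -> Cplx R) (c : R[i]).

Lemma sumsq_ge0 x : (0 <= sumsq x)%E.
Proof. by apply: esum_ge0 => n _; rewrite lee_fin sqr_ge0. Qed.

Lemma sumsq0 : sumsq (0 : int -> Cplx R) = 0%E.
Proof. by apply: esum1 => n _; rewrite [X in normc X](_ : _ = 0)// normc0 expr0n. Qed.

Lemma normcE (z : R[i]) : (normc z)%:C = `|z|.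
Proof. by []. Qed.

Lemma normc_nneg (z : R[i]) : 0 <= normc z.
Proof. by case: z => a b; rewrite sqrtr_ge0. Qed.

Lemma normc_triangle (z w : R[i]) : normc (z + w) <= normc z + normc w.
Proof. by have := ler_normD z w; rewrite -!normcE -raddfD lecR. Qed.

Lemma esumZ_le (k : R) (u : int -> R) : 0 <= k -> (forall n, 0 <= u n) ->
  (\esum_(n in [set: int]) (k * u n)%:E
     <= k%:E * \esum_(n in [set: int]) (u n)%:E)%E.
Proof.
move=> k0 u0; apply: ge_ereal_sup => _ [A [fA _] <-].
rewrite (eq_fsbigr (fun n => k%:E * (u n)%:E)%E)//.
rewrite -ge0_mule_fsumr; last by move=> n; rewrite lee_fin.
by apply: lee_wpmul2l => //; apply: ereal_sup_ubound; exists A.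
Qed.

Lemma sumsqZ_le c x : (sumsq (c *: x) <= ((normc c) ^+ 2)%:E * sumsq x)%E.
Proof.
rewrite /sumsq.
rewrite (eq_esum (b := fun n => ((normc c) ^+ 2 * (normc (x n)) ^+ 2)%:E)).
  by apply: esumZ_le => [|n]; exact: sqr_ge0.
by move=> n _; rewrite -exprMn -normcM.
Qed.

Lemma normcD_sqr (t : R) (z w : R[i]) : 0 < t ->
  normc (z + w) ^+ 2 <= (1 + t) * normc z ^+ 2 + (1 + t^-1) * normc w ^+ 2.
Proof.
move=> t0; set a := normc z; set b := normc w.
apply: (@le_trans _ _ ((a + b) ^+ 2)).
  by rewrite ler_sqr ?nnegrE ?addr_ge0 ?normc_nneg ?normc_triangle.
rewrite -subr_ge0.
suff -> : (1 + t) * a ^+ 2 + (1 + t^-1) * b ^+ 2 - (a + b) ^+ 2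
   = t^-1 * (t * a - b) ^+ 2 by rewrite mulr_ge0 ?sqr_ge0// invr_ge0 ltW.
by field; rewrite gt_eqF.
Qed.


Lemma sumsqD_le (t : R) x y : 0 < t ->
  (sumsq (x + y)%R <= (1 + t)%:E * sumsq x + (1 + t^-1)%:E * sumsq y)%E.
Proof.
move=> t0; have ti0 : 0 < t^-1 by rewrite invr_gt0.
apply: (@le_trans _ _ (\esum_(n in [set: int])
   (((1 + t) * normc (x n) ^+ 2)%:E + ((1 + t^-1) * normc (y n) ^+ 2)%:E))%E).
  by apply: le_esum => n _; rewrite -EFinD lee_fin normcD_sqr.
have t1 : 0 <= 1 + t by rewrite addr_ge0// ltW.
have ti1 : 0 <= 1 + t^-1 by rewrite addr_ge0// ltW.
rewrite esumD => [|n _|n _]; last 2 first.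
- by rewrite lee_fin mulr_ge0// sqr_ge0.
- by rewrite lee_fin mulr_ge0// sqr_ge0.
by apply: leeD; apply: esumZ_le => // n; exact: sqr_ge0.
Qed.

Lemma square_summable_submod : submod_closed (@square_summable R).
Proof.
split; first by rewrite unfold_in sumsq0 ltry.
move=> c x y; rewrite !unfold_in => xo yo.
have := sumsqD_le (c *: x) y (@ltr01 R).
move/le_lt_trans; apply; rewrite invr1 lte_add_pinfty// lte_mul_pinfty//.
by apply: (le_lt_trans (sumsqZ_le c x)); rewrite lte_mul_pinfty// lee_fin sqr_ge0.
Qed.

HB.instance Definition _ := GRing.isSubmodClosed.Build R[i] (int -> Cplx R)
  (@square_summable R) square_summable_submod.

Record ell2 := Ell2 {
  ell2_fun :> int -> Cplx R ;
  ell2_summable : ell2_fun \in @square_summable R }.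

HB.instance Definition _ := [isSub for ell2_fun].
HB.instance Definition _ := [Choice of ell2 by <:].
HB.instance Definition _ := [SubChoice_isSubLmodule of ell2 by <:].


Definition ell2_norm (psi : ell2) : R := Num.sqrt (fine (sumsq psi)).

Implicit Types u v : ell2.

Lemma sumsq_fin u : sumsq u = (fine (sumsq u))%:E.
Proof.
rewrite fineK// ge0_fin_numE ?sumsq_ge0//.
by have := ell2_summable u; rewrite unfold_in.
Qed.

Lemma ell2_norm_ge0 u : 0 <= ell2_norm u.
Proof. exact: sqrtr_ge0. Qed.

Lemma ell2_norm_sqr u : (ell2_norm u ^+ 2)%:E = sumsq u.
Proof. by rewrite sqr_sqrtr -?sumsq_fin// fine_ge0 ?sumsq_ge0. Qed.

Lemma ell2_norm0_eq0 u : ell2_norm u = 0 -> u = 0.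
Proof.
move=> u0; apply: val_inj; apply/funext => n /=.
apply: eq0_normc; apply/eqP; rewrite -sqrf_eq0 eq_le sqr_ge0 andbT -lee_fin.
have := ell2_norm_sqr u; rewrite u0 expr0n => ->.
by apply: esum_ge; exists [set n]; rewrite ?fsbig_set1//; split.
Qed.

Lemma ell2_normD_sqr (t : R) u v : 0 < t ->
  ell2_norm (u + v) ^+ 2
    <= (1 + t) * ell2_norm u ^+ 2 + (1 + t^-1) * ell2_norm v ^+ 2.
Proof.
move=> t0; rewrite -lee_fin EFinD [X in (_ <= X + _)%E]EFinM [X in (_ <= _ + X)%E]EFinM.
rewrite !ell2_norm_sqr.
exact: sumsqD_le.
Qed.

Lemma ell2_normD u v : ell2_norm (u + v) <= ell2_norm u + ell2_norm v.
Proof.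
have [/ell2_norm0_eq0 ->|u0] := eqVneq (ell2_norm u) 0.
  by rewrite add0r lerDr ell2_norm_ge0.
have [/ell2_norm0_eq0 ->|v0] := eqVneq (ell2_norm v) 0.
  by rewrite addr0 lerDl ell2_norm_ge0.
have up : 0 < ell2_norm u by rewrite lt_neqAle eq_sym u0 ell2_norm_ge0.
have vp : 0 < ell2_norm v by rewrite lt_neqAle eq_sym v0 ell2_norm_ge0.
rewrite -(@ler_pXn2r _ 2)// ?nnegrE ?addr_ge0 ?ell2_norm_ge0//.
apply: (le_trans (ell2_normD_sqr u v (divr_gt0 vp up))).
by rewrite le_eqVlt; apply/orP; left; apply/eqP; field; rewrite u0 v0.
Qed.

Lemma ell2_normZ_le c u : ell2_norm (c *: u) <= normc c * ell2_norm u.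
Proof.
rewrite -(@ler_pXn2r _ 2)// ?nnegrE ?mulr_ge0 ?normc_nneg ?ell2_norm_ge0//.
rewrite exprMn -lee_fin [X in (_ <= X)%E]EFinM !ell2_norm_sqr.
exact: sumsqZ_le.
Qed.

Lemma ell2_normZ c u : ell2_norm (c *: u) = normc c * ell2_norm u.
Proof.
have [->|c0] := eqVneq c 0.
  rewrite scale0r normc0 mul0r.
  apply/eqP; rewrite sqrtr_eq0; rewrite (_ : sumsq _ = 0%E)//; exact: sumsq0.
apply/eqP; rewrite eq_le ell2_normZ_le/=.
have := ell2_normZ_le c^-1 (c *: u); rewrite scalerA mulVf// scale1r normcV.
have nc : 0 < normc c.
  rewrite lt_neqAle normc_nneg andbT eq_sym.
  by apply: contra c0 => /eqP/eq0_normc/eqP.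
by rewrite mulrC ler_pdivlMr// mulrC.
Qed.

(* Norms of R[i]-modules take values in R[i], whence the injection %:C. *)
Definition ell2_normC u : R[i] := (ell2_norm u)%:C.

Lemma ell2_normCD u v : ell2_normC (u + v) <= ell2_normC u + ell2_normC v.
Proof. by rewrite /ell2_normC -raddfD lecR ell2_normD. Qed.

Lemma ell2_normCZ c u : ell2_normC (c *: u) = `|c| * ell2_normC u.
Proof. by rewrite /ell2_normC ell2_normZ rmorphM. Qed.

Lemma ell2_normC_eq0 u : ell2_normC u = 0 -> u = 0.
Proof. by case=> /ell2_norm0_eq0. Qed.

HB.instance Definition _ := Lmodule_isNormed.Build R[i] ell2
  ell2_normCD ell2_normCZ ell2_normC_eq0.

End Ell2.

(* For linear maps, continuity is boundedness. *)
Definition boundedly_invertible (K : numFieldType) (V : normedModType K)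
    (A : V -> V) : Prop :=
  exists S : {linear V -> V}, [/\ continuous S, cancel A S & cancel S A].

Definition spectrum (K : numFieldType) (V : normedModType K) (A : V -> V) :
    set K :=
  [set z | ~ boundedly_invertible (fun v => A v - z *: v)].

Definition resolvent_set (K : numFieldType) (V : normedModType K)
    (A : V -> V) : set K :=
  ~` spectrum A.

(* T^n for n in Z, where Tinv is the inverse of T. *)
Definition iterz (X : Type) (T Tinv : X -> X) (n : int) : X -> X :=
  match n with
  | Posz m => iter m T
  | Negz m => iter m.+1 Tinv
  end.

Definition jacobi_expr (R : realType) (Omega : Type) (T Tinv : Omega -> Omega)
    (a : Omega -> Cplx R) (b : Omega -> R) (w : Omega)
    (psi : int -> Cplx R) : int -> Cplx R :=
  fun n => (a (iterz T Tinv (n - 1) w))^* * psi (n - 1)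
           + a (iterz T Tinv n w) * psi (n + 1)
           + (b (iterz T Tinv n w))%:C * psi n.

Section JacobiSummable.
Variable R : realType.
Implicit Types (x m : int -> Cplx R).

Lemma square_summable_shift (k : int) x : x \in @square_summable R ->
  (fun n => x (n + k)) \in @square_summable R.
Proof.
rewrite !unfold_in /sumsq => xo.
rewrite -(@reindex_esum R int int setT setT (fun n => n + k)
            (fun n => ((normc (x n)) ^+ 2)%:E))//.
split=> //.
- by move=> p q _ _; exact: addIr.
- by move=> p _; exists (p - k) => //; rewrite subrK.
Qed.

Lemma square_summable_mul (M : R) m x : (forall n, normc (m n) <= M) ->
  x \in @square_summable R ->
  (fun n => m n * x n) \in @square_summable R.
Proof.
move=> mM; rewrite !unfold_in => xo.
have M0 : 0 <= M by apply: le_trans (mM 0); exact: normc_nneg.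
apply: (@le_lt_trans _ _ ((M ^+ 2)%:E * sumsq x)%E); last first.
  by rewrite lte_mul_pinfty// lee_fin sqr_ge0.
apply: le_trans (esumZ_le (sqr_ge0 M) (fun n => sqr_ge0 (normc (x n)))).
apply: le_esum => n _; rewrite lee_fin normcM exprMn ler_wpM2r ?sqr_ge0//.
by rewrite ler_sqr ?nnegrE ?normc_nneg.
Qed.

Lemma compact_norm_bounded (Omega : topologicalType) (f : Omega -> R) :
  compact [set: Omega] -> continuous f ->
  exists M : R, forall w, `|f w| <= M.
Proof.
move=> cO cf; have : bounded_set (f @` setT).
  apply: compact_bounded.
  by apply: continuous_compact => //; exact: continuous_subspaceT.
move=> [M0 [M0r]] /(_ (M0 + 1)); rewrite ltrDl ltr01 => /(_ isT) fM.
by exists (M0 + 1) => v; apply: fM; exists v.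
Qed.

Lemma normc_continuous : continuous (@normc R : Cplx R -> R).
Proof.
move=> z; apply/(@cvgrPdist_lt _ _ _ (nbhs z) (nbhs_filter z)) => e e0.
have : \forall w \near z, `|z - w| < e%:C.
  by apply/nbhs_ballP; exists e%:C => //=; rewrite ltcR.
apply: filterS => w; rewrite -normcE ltcR; apply: le_lt_trans.
have h1 := normc_triangle (w - z) z; have h2 := normc_triangle (z - w) w.
rewrite !subrK in h1 h2; rewrite -opprB normcN in h1.
by rewrite ler_norml; apply/andP; split; lra.
Qed.

Lemma compact_normc_bounded (Omega : topologicalType) (f : Omega -> Cplx R) :
  compact [set: Omega] -> continuous f ->
  exists M : R, forall w, normc (f w) <= M.
Proof.
move=> cO cf.
have /(compact_norm_bounded cO)[M fM] : continuous (fun w => normc (f w)).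
  by move=> w; apply: continuous_comp; [exact: cf | exact: normc_continuous].
by exists M => w; apply: le_trans (fM w); exact: ler_norm.
Qed.

Lemma normc_conjc (z : R[i]) : normc (z^*) = normc z.
Proof. by case: z => p q /=; rewrite sqrrN. Qed.

Lemma normc_real (t : R) : normc (t%:C) = `|t|.
Proof. by rewrite /= expr0n addr0 sqrtr_sqr. Qed.

Lemma jacobi_summable (Omega : topologicalType) (T Tinv : Omega -> Omega)
    (a : Omega -> Cplx R) (b : Omega -> R) (cO : compact [set: Omega])
    (ca : continuous a) (cb : continuous b) (w : Omega) (psi : ell2 R) :
  jacobi_expr T Tinv a b w psi \in @square_summable R.
Proof.
have [Ma aM] := compact_normc_bounded cO ca.
have [Mb bM] := compact_norm_bounded cO cb.
have psio := ell2_summable psi.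
apply: rpredD; first apply: rpredD.
- apply: (square_summable_mul (M := Ma)); last exact: square_summable_shift.
  by move=> n; rewrite normc_conjc.
- apply: (square_summable_mul (M := Ma)); last exact: square_summable_shift.
  by move=> n.
- apply: (square_summable_mul (M := Mb)) => // n.
  by rewrite normc_real.
Qed.

End JacobiSummable.

Definition jacobi_op (R : realType) (Omega : topologicalType)
    (T Tinv : Omega -> Omega) (a : Omega -> Cplx R) (b : Omega -> R)
    (cO : compact [set: Omega]) (ca : continuous a) (cb : continuous b)
    (w : Omega) (psi : ell2 R) : ell2 R :=
  Ell2 (jacobi_summable T Tinv cO ca cb w psi).

Definition jacobi_cocycle (R : realType) (Omega : Type)
    (Tinv : Omega -> Omega) (a : Omega -> Cplx R) (b : Omega -> R)
    (E : Cplx R) (w : Omega) : 'M[Cplx R]_2 :=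
  \matrix_(i < 2, j < 2)
    if i == 0 then (if j == 0 then E - (b w)%:C else - (a (Tinv w))^*)
    else (if j == 0 then a w else 0).

Definition cocycle_iter (R : realType) (Omega : Type) (T : Omega -> Omega)
    (B : Omega -> 'M[Cplx R]_2) : nat -> Omega -> 'M[Cplx R]_2 :=
  fix iterB n w :=
    if n is n'.+1 then B (iter n' T w) *m iterB n' w else 1%:M.

(* The norm of the library on matrices is the sup norm; C^2 carries the
   Euclidean norm here. *)
Definition euclid_norm (R : realType) (v : 'cV[Cplx R]_2) : R :=
  Num.sqrt (\sum_(i < 2) (normc (v i 0)) ^+ 2).

Definition CP1 (R : realType) := one_point_compactification (Cplx R).

(* z in C is the line spanned by (1, z), infinity the line spanned by (0, 1). *)
Definition direction (R : realType) (p : CP1 R) : 'cV[Cplx R]_2 :=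
  if p is Some z then \col_(i < 2) (if i == 0 then 1 else z)
  else \col_(i < 2) (if i == 0 then 0 else 1).

Definition line (R : realType) (p : CP1 R) : set 'cV[Cplx R]_2 :=
  [set c *: direction p | c in [set: R[i]]].

Definition dominated_splitting (R : realType) (Omega : topologicalType)
    (T : Omega -> Omega) (B : Omega -> 'M[Cplx R]_2) : Prop :=
  exists Es Eu : Omega -> CP1 R,
    [/\ continuous Es /\ continuous Eu,
        forall w,
          [set B w *m v | v in line (Es w)] `<=` line (Es (T w)) /\
          [set B w *m v | v in line (Eu w)] `<=` line (Eu (T w))
      & exists (N : nat) (lambda : R),
          [/\ (0 < N)%N, 1 < lambda &
              forall w (u s : 'cV[Cplx R]_2),
                line (Eu w) u -> line (Es w) s ->
                euclid_norm u = 1 -> euclid_norm s = 1 ->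
                lambda * euclid_norm (cocycle_iter T B N w *m s)
                  < euclid_norm (cocycle_iter T B N w *m u)]].

(* Main.v *)
(* Let s and u be unit vectors spanning E^s and E^u, so that B s = q s' and
   B u = p u', where a prime denotes the value at T w, and let D = det(s, u).
   By compactness |p| and |D| are bounded below.  In the coordinates
   (psi n, psi (n-1)) = x s + y u, the equation (J - E) psi = f decouples into
     x' = k x + u_1 f / (p D'),   y = r y' + s_2' f / (p D'),
   where r = a / p and k = conj(a(T^-1 w)) D / (p D').  These coefficients are
   bounded even where a vanishes, because q = a k.  Since
   k r = q / p, domination makes the products of k r along orbits decay
   geometrically; products of |k| and of |r| over the same block agree up to a
   shift of a by one step and a bounded factor, so each of them decays.  Hence
   x is solved from the past and y from the future, boundedly on l^2, and the
   homogeneous equation has no nonzero bounded solution. *)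

From HB Require Import structures.
Require Import Defs.
From mathcomp Require Import all_boot all_order all_algebra.
From mathcomp Require Import complex.
From mathcomp Require Import all_classical all_reals all_analysis.
From mathcomp Require Import ring lra.
Import Order.TTheory GRing.Theory Num.Theory.
Import numFieldNormedType.Exports.
Import Normc.
Local Open Scope classical_set_scope.
Local Open Scope ring_scope.
Set Implicit Arguments.
Unset Strict Implicit.
Unset Printing Implicit Defensive.

(** * Geometric decay along an orbit *)

Section GeometricDecay.
Variable R : realType.
Implicit Types (x y z : int -> R).

(** The constants are uniform in the starting point [m]; this gives invariance under reversal and
    bounds on all of l^2(Z). *)
Definition geom_decay x : Prop :=
  exists C mu : R, [/\ 0 <= C, 0 < mu < 1 &
    forall (m : int) (k : nat), \prod_(i < k) x (m + i%:Z) <= C * mu ^+ k].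

Lemma prod_shift_recl x m k :
  \prod_(i < k.+1) x (m + i%:Z) = x m * \prod_(i < k) x (m + 1 + i%:Z).
Proof.
rewrite big_ord_recl addr0; congr (_ * _); apply: eq_bigr => i _.
by rewrite -addrA; congr (x (_ + _)); rewrite /= /bump /= intS.
Qed.

Lemma prod_shift_ge0 x m k : (forall j, 0 <= x j) ->
  0 <= \prod_(i < k) x (m + i%:Z).
Proof. by move=> x0; apply: prodr_ge0. Qed.

(** Strong induction on [k] peels off blocks of length [N], each contributing [theta = mu ^+ N]; the
    fewer than [N] factors left over are absorbed into the constant. *)
Lemma block_geom_decay z (K theta : R) (N : nat) :
  (0 < N)%N -> 0 < theta < 1 -> (forall j, 0 <= z j <= K) ->
  (forall m, \prod_(i < N) z (m + i%:Z) <= theta) -> geom_decay z.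
Proof.
move=> N0 /andP[t0 t1] zK zt.
pose mu := theta `^ (N%:R^-1).
have mu0 : 0 < mu by exact: powR_gt0.
have muN : mu ^+ N = theta.
  by rewrite -powR_mulrn ?powR_ge0// -powRrM mulVf ?powRr1 ?ltW// pnatr_eq0 -lt0n.
have mu1 : mu < 1.
  by rewrite ltNge; apply/negP => /(@exprn_ege1 _ N); rewrite muN leNgt t1.
pose L := Num.max K 1.
have L1 : 1 <= L by rewrite le_max lexx orbT.
have L0 : 0 <= L by rewrite (le_trans ler01).
have zL j : 0 <= z j <= L.
  by have /andP[-> h] := zK j; rewrite le_max h.
have z0 j : 0 <= z j by case/andP: (zL j).
have C0 : 0 <= (L / mu) ^+ N by rewrite exprn_ge0// divr_ge0// ltW.
exists ((L / mu) ^+ N), mu; split => //; first by rewrite mu0.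
move=> m k; elim/ltn_ind: k m => k IH m.
have [kN|Nk] := ltnP k N.
  apply: (@le_trans _ _ (L ^+ k)).
    rewrite -[L ^+ k](_ : \prod_(i < k) L = _); last by rewrite prodr_const card_ord.
    by apply: ler_prod => i _; exact: zL.
  apply: (@le_trans _ _ (L ^+ N)); first by rewrite ler_weXn2l// ltnW.
  rewrite expr_div_n -mulrA ler_peMr ?exprn_ge0//.
  rewrite mulrC ler_pdivlMr ?exprn_gt0// mul1r.
  by apply: ler_wiXn2l; rewrite ?(ltW mu0) ?(ltW mu1) ?(ltnW kN).
rewrite -(subnKC Nk) big_split_ord /= exprD [X in _ <= X]mulrCA muN.
apply: ler_pM; rewrite ?prodr_ge0//.
rewrite (eq_bigr (fun i : 'I_(k - N) => z (m + N%:Z + i%:Z))); last first.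
  by move=> i _; rewrite PoszD addrA.
by apply: IH; rewrite ltn_subrL N0 (leq_trans N0 Nk).
Qed.

(* Over a block, the products of [A j] and of [A (j - 1)] differ only in their
   end factors, so decay of the combined product forces decay of each. *)
Lemma geom_decay_factors (A p D : int -> R) (M d e S : R) :
  0 < d -> 0 < e ->
  (forall j, 0 <= A j <= M) -> (forall j, d <= p j) ->
  (forall j, e <= D j <= S) ->
  geom_decay (fun j => A j * A (j - 1) * D j / (p j ^+ 2 * D (j + 1))) ->
  geom_decay (fun j => A j / p j) /\
  geom_decay (fun j => A (j - 1) * D j / (p j * D (j + 1))).
Proof.
move=> d0 e0 AM pd De [C [mu [C0 /andP[mu0 mu1] zC]]].
have A0 j : 0 <= A j by case/andP: (AM j).
have AleM j : A j <= M by case/andP: (AM j).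
have M0 : 0 <= M by apply: le_trans (AleM 0).
have p0 j : 0 < p j by apply: lt_le_trans (pd j).
have D0 j : 0 < D j by apply: lt_le_trans e0 _; case/andP: (De j).
have p0' j := ltW (p0 j); have D0' j := ltW (D0 j).
have S0 : 0 <= S by apply: le_trans (ltW (D0 0)) _; case/andP: (De 0).
pose r j := A j / p j; pose y j := A (j - 1) * D j / (p j * D (j + 1)).
have r0 j : 0 <= r j by rewrite divr_ge0// ltW.
have y0 j : 0 <= y j by rewrite divr_ge0 ?mulr_ge0// ?ltW.
pose X m k := \prod_(i < k) r (m + i%:Z).
pose Y m k := \prod_(i < k) y (m + i%:Z).
have X0 m k : 0 <= X m k by exact: prod_shift_ge0.
have Y0 m k : 0 <= Y m k by exact: prod_shift_ge0.
pose L := M * S / (d * e).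
have L0 : 0 <= L by rewrite divr_ge0 ?mulr_ge0// ltW.
have leL i j k l : A i * D j / (p k * D l) <= L.
  apply: ler_pM; rewrite ?invr_ge0 ?mulr_ge0//.
    by apply: ler_pM => //; case/andP: (De j).
  rewrite lef_pV2 ?posrE ?mulr_gt0//.
  by apply: ler_pM; rewrite ?(ltW d0) ?(ltW e0)//; case/andP: (De l).
(* The quotients D j / D (j + 1) telescope, and the factors A in [Y] are those in [X] moved by one
   step, so only end factors remain. *)
have YX m k : Y m k.+1 =
    X m k * (A (m - 1) * D m / (p (m + k%:Z) * D (m + k%:Z + 1))).
  elim: k => [|k IH].
    by rewrite /Y /X big_ord_recr !big_ord0 /= !mul1r addr0.
  rewrite /Y big_ord_recr /= -/(Y _ _) IH /X big_ord_recr /= -/(X _ _) /y /r.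
  rewrite intS (addrC 1) !addrA addrK; field.
  by rewrite !gt_eqF.
have XY m k : X m k.+1 = Y (m + 1) k *
    (A (m + k%:Z) * D (m + k%:Z + 1) / (p m * D (m + 1))).
  elim: k => [|k IH].
    rewrite /Y /X big_ord_recr !big_ord0 /= !mul1r addr0 /r; field.
    by rewrite !gt_eqF.
  rewrite /X big_ord_recr /= -/(X _ _) IH /Y big_ord_recr /= -/(Y _ _) /y /r.
  rewrite intS !(addrC 1) !addrA [m + 1 + _]addrAC addrK; field.
  by rewrite !gt_eqF.
have XYz m k : X m k * Y m k <= C * mu ^+ k.
  apply: le_trans (zC m k); rewrite -big_split le_eqVlt; apply/orP; left.
  apply/eqP/eq_bigr => i _ /=; rewrite /r /y; field.
  by rewrite !gt_eqF.
pose nu := Num.sqrt mu.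
have nu2 : nu ^+ 2 = mu by rewrite sqr_sqrtr// ltW.
have nu0 : 0 < nu by rewrite sqrtr_gt0.
have nu1 : nu < 1.
  by rewrite ltNge; apply/negP => /(@exprn_ege1 _ 2); rewrite nu2 leNgt mu1.
pose G := (M / d) * L * C.
have Md0 : 0 <= M / d by rewrite divr_ge0// ltW.
have G0 : 0 <= G by apply: mulr_ge0 => //; exact: mulr_ge0.
(* One copy of [X] gives up its first factor, the other is rewritten by [XY]; [XYz] bounds what
   remains. The square turns the rate [mu] into its root [nu]. *)
have X2 m k : X m k.+1 ^+ 2 <= G * mu ^+ k.
  rewrite expr2 {1}/X prod_shift_recl -/(X _ _) XY.
  have rM : r m <= M / d.
    by apply: ler_pM; rewrite ?invr_ge0// lef_pV2 ?posrE.
  have YL := ler_wpM2l (Y0 (m + 1) k) (leL (m + k%:Z) (m + k%:Z + 1) m (m + 1)).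
  have XL : r m * X (m + 1) k <= M / d * X (m + 1) k by rewrite ler_wpM2r.
  apply: le_trans (ler_pM _ _ XL YL) _.
  - exact: mulr_ge0.
  - by apply: mulr_ge0 => //; rewrite divr_ge0 ?mulr_ge0.
  rewrite /G -[_ * C * _]mulrA.
  rewrite (_ : M / d * X (m + 1) k * (Y (m + 1) k * L) =
     M / d * L * (X (m + 1) k * Y (m + 1) k)); last by ring.
  by apply: ler_wpM2l => //; exact: mulr_ge0.
have X1 m k : X m k.+1 <= Num.sqrt G * nu ^+ k.
  rewrite -(@ler_pXn2r _ 2)// ?nnegrE ?mulr_ge0 ?exprn_ge0 ?sqrtr_ge0// ?(ltW nu0)//.
  by rewrite exprMn sqr_sqrtr// -exprM mulnC exprM nu2.
(* The summand 1 covers the empty product, the division by [nu] the shift from [k] to [k.+1]. *)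
have Xd m k : X m k <= (1 + Num.sqrt G / nu) * nu ^+ k.
  case: k => [|k].
    by rewrite /X big_ord0 mulr1 lerDl divr_ge0 ?sqrtr_ge0// ltW.
  apply: le_trans (X1 m k) _; rewrite exprS mulrA ler_wpM2r ?exprn_ge0 ?(ltW nu0)//.
  by rewrite mulrDl mul1r divfK ?gt_eqF// lerDr ltW.
have H0 : 0 <= 1 + Num.sqrt G / nu by rewrite addr_ge0 ?divr_ge0 ?sqrtr_ge0// ltW.
split; first by exists (1 + Num.sqrt G / nu), nu; rewrite nu0.
have HL : 0 <= (1 + Num.sqrt G / nu) * L / nu.
  by apply: divr_ge0; rewrite ?(ltW nu0)//; exact: mulr_ge0.
exists (1 + (1 + Num.sqrt G / nu) * L / nu), nu; split; rewrite ?nu0//.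
  exact: addr_ge0.
move=> m [|k]; first by rewrite big_ord0 mulr1 lerDl.
rewrite -/(Y _ _) YX exprS [X in _ <= X]mulrA [X in _ <= X * _]mulrDl mul1r divfK ?gt_eqF//.
apply: (@le_trans _ _ ((1 + Num.sqrt G / nu) * nu ^+ k * L)).
  apply: ler_pM => //.
  by rewrite mulr_ge0 ?invr_ge0 ?mulr_ge0// ltW.
by rewrite mulrAC [X in _ <= X]mulrDl lerDr mulr_ge0 ?exprn_ge0// ltW.
Qed.

(** A window read backwards is again a window, here starting at c - m - k + 1. *)
Lemma geom_decay_rev x (c : int) : geom_decay x -> geom_decay (fun j => x (c - j)).
Proof.
move=> [C [mu [C0 mu01 xC]]]; exists C, mu; split => // m k.
apply: le_trans (xC (c - m - k%:Z + 1) k).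
rewrite (reindex_inj rev_ord_inj) /= le_eqVlt; apply/orP; left; apply/eqP.
apply: eq_bigr => i _; congr (x _).
rewrite -subzn ?ltn_ord// intS; ring.
Qed.

End GeometricDecay.

(** * First-order recursions on l^2(Z) *)

Section Modulus.
Variable R : realType.

Lemma normc_sqr (z : R[i]) : normc z ^+ 2 = complex.Re z ^+ 2 + complex.Im z ^+ 2.
Proof. by case: z => p q; rewrite sqr_sqrtr// addr_ge0 ?sqr_ge0. Qed.

Lemma Re_le_normc (z : R[i]) : `|complex.Re z| <= normc z.
Proof.
rewrite -(@ler_pXn2r _ 2)// ?nnegrE ?normc_nneg// normc_sqr real_normK ?num_real//.
by rewrite lerDl sqr_ge0.
Qed.

Lemma Im_le_normc (z : R[i]) : `|complex.Im z| <= normc z.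
Proof.
rewrite -(@ler_pXn2r _ 2)// ?nnegrE ?normc_nneg// normc_sqr real_normK ?num_real//.
by rewrite lerDr sqr_ge0.
Qed.

Lemma normc_le_ReIm (z : R[i]) : normc z <= `|complex.Re z| + `|complex.Im z|.
Proof.
rewrite -(@ler_pXn2r _ 2)// ?nnegrE ?normc_nneg ?addr_ge0// normc_sqr.
rewrite -(real_normK (num_real (complex.Re z))) -(real_normK (num_real (complex.Im z))).
by rewrite sqrrD lerD2r lerDl mulrn_wge0// mulr_ge0.
Qed.

Lemma normc_prod (k : nat) (F : 'I_k -> R[i]) :
  normc (\prod_(i < k) F i) = \prod_(i < k) normc (F i).
Proof.
elim/big_ind2: _ => //; first by rewrite -[1]/(1%:C)%C normc_real normr1.
by move=> _ u _ v <- <-; rewrite normcM.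
Qed.

Lemma normc_neq0 (r : R) (z : R[i]) : 0 < r -> r <= normc z -> z != 0.
Proof.
move=> r0 rz; apply/eqP => z0; move: (lt_le_trans r0 rz).
by rewrite z0 normc0 ltxx.
Qed.

Lemma normc_ge_sqrt (d : R) (z : R[i]) :
  d <= normc z ^+ 2 -> Num.sqrt d <= normc z.
Proof.
move=> dz; rewrite -[normc z]ger0_norm ?normc_nneg// -sqrtr_sqr.
exact: ler_wsqrtr.
Qed.

End Modulus.

(** * Square-summable sequences: finite sums, reindexing, pointwise limits *)

Section Ell2Complements.
Variable R : realType.
Implicit Types (g x y : ell2 R).

Lemma ell2_addE x y n : (x + y) n = x n + y n.
Proof. by []. Qed.

Lemma ell2_zeroE n : (0 : ell2 R) n = 0.
Proof. by []. Qed.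

Lemma fsum_le_ell2_norm_sqr x (A : set int) : finite_set A ->
  \sum_(n \in A) normc (x n) ^+ 2 <= ell2_norm x ^+ 2.
Proof.
move=> fA; rewrite -lee_fin ell2_norm_sqr -fsumEFin//.
by apply: ereal_sup_ubound; exists A.
Qed.

Lemma normc_le_ell2_norm x n : normc (x n) <= ell2_norm x.
Proof.
rewrite -(@ler_pXn2r _ 2)// ?nnegrE ?normc_nneg ?ell2_norm_ge0//.
by have := fsum_le_ell2_norm_sqr x (finite_set1 n); rewrite fsbig_set1.
Qed.

Lemma ell2_of_bound (f : int -> Cplx R) (M : R) : 0 <= M ->
  (forall A : set int, finite_set A ->
     \sum_(n \in A) normc (f n) ^+ 2 <= M ^+ 2) ->
  exists x : ell2 R, (forall n, x n = f n) /\ ell2_norm x <= M.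
Proof.
move=> M0 fM.
have fle : (sumsq f <= (M ^+ 2)%:E)%E.
  apply: ge_ereal_sup => _ [A [fA _] <-].
  by rewrite fsumEFin// lee_fin; exact: fM.
have fs : f \in @square_summable R.
  by rewrite unfold_in; apply: le_lt_trans fle _; exact: ltry.
exists (Ell2 fs); split => //.
rewrite -(@ler_pXn2r _ 2)// ?nnegrE ?ell2_norm_ge0//.
by rewrite -lee_fin ell2_norm_sqr.
Qed.

(** One tool for bounded multipliers, shifts and reflections: as [e] is injective, a finite sum over
    [A] is one over its image, which the norm of [g] bounds. *)
Lemma ell2_mul_reindex (M : R) (m : int -> Cplx R) (e : int -> int) g :
  (forall n, normc (m n) <= M) -> injective e ->
  exists x : ell2 R, (forall n, x n = m n * g (e n)) /\
    ell2_norm x <= M * ell2_norm g.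
Proof.
move=> mM ie.
have M0 : 0 <= M by apply: le_trans (mM 0); exact: normc_nneg.
apply: ell2_of_bound => [|A fA]; first by rewrite mulr_ge0 ?ell2_norm_ge0.
have feA : finite_set (e @` A) by exact: finite_image.
rewrite exprMn.
apply: le_trans (ler_wpM2l (sqr_ge0 M) (fsum_le_ell2_norm_sqr g feA)).
rewrite (_ : \sum_(n \in e @` A) _ = \sum_(n \in A) normc (g (e n)) ^+ 2); last first.
  by apply: reindex_fsbig; split=> // p q _ _; exact: ie.
rewrite !fsbig_finite//= mulr_sumr; apply: ler_sum => n _.
by rewrite normcM exprMn ler_wpM2r ?sqr_ge0// ler_sqr ?nnegrE ?normc_nneg.
Qed.

Lemma cvg_sum_seq (I : Type) (r : seq I) (F : nat -> I -> R) (l : I -> R) :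
  (forall i, F ^~ i @ \oo --> l i) ->
  (fun k => \sum_(i <- r) F k i) @ \oo --> \sum_(i <- r) l i.
Proof.
move=> Fl; elim: r => [|i r IH].
  rewrite big_nil (_ : (fun _ => _) = fun=> 0); first exact: cvg_cst.
  by apply/funext => k; rewrite big_nil.
rewrite big_cons (_ : (fun _ => _) = (fun k => F k i + \sum_(j <- r) F k j)).
  exact: cvgD.
by apply/funext => k; rewrite big_cons.
Qed.

(** A Fatou argument: every finite sum of squares passes to the limit. *)
Lemma ell2_of_pointwise_limit (y : nat -> ell2 R) (f : int -> Cplx R) (M : R) :
  (forall k, ell2_norm (y k) <= M) ->
  (forall n, (fun k => complex.Re (y k n)) @ \oo --> complex.Re (f n)) ->
  (forall n, (fun k => complex.Im (y k n)) @ \oo --> complex.Im (f n)) ->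
  exists x : ell2 R, (forall n, x n = f n) /\ ell2_norm x <= M.
Proof.
move=> yM yRe yIm.
have M0 : 0 <= M by apply: le_trans (yM 0); exact: ell2_norm_ge0.
apply: ell2_of_bound => // A fA.
have cA : (fun k => \sum_(n \in A) normc (y k n) ^+ 2) @ \oo -->
    \sum_(n \in A) normc (f n) ^+ 2.
  rewrite fsbig_finite//=; under eq_fun do rewrite fsbig_finite//=.
  apply: cvg_sum_seq => n; rewrite normc_sqr.
  under eq_fun do rewrite normc_sqr.
  by apply: cvgD; rewrite !expr2; apply: cvgM.
apply: cvgr_to_le cA _.
apply: nearW => k; apply: le_trans (fsum_le_ell2_norm_sqr _ fA) _.
by rewrite ler_sqr ?nnegrE ?ell2_norm_ge0.
Qed.

End Ell2Complements.

(** * Bounded solutions of x (n + 1) = kap n x n + g n *)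

Section Recursion.
Variable R : realType.
Variable kap : int -> Cplx R.
Hypothesis kap_decay : geom_decay (fun n => normc (kap n)).

(** Going [k] steps back gives |x n| <= C M mu^k for every [k]. *)
Lemma recursion_uniq (x : int -> Cplx R) (M : R) :
  (forall n, normc (x n) <= M) -> (forall n, x (n + 1) = kap n * x n) ->
  forall n, x n = 0.
Proof.
move=> xM xk n.
have M0 : 0 <= M by apply: le_trans (xM 0); exact: normc_nneg.
have [C [mu [C0 /andP[mu0 mu1] kC]]] := kap_decay.
have xP m k : x (m + k%:Z) = \prod_(i < k) kap (m + i%:Z) * x m.
  elim: k => [|k IH]; first by rewrite big_ord0 mul1r addr0.
  by rewrite intS (addrC 1) addrA xk IH big_ord_recr /=; ring.
have xn k : normc (x n) <= C * M * mu ^+ k.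
  rewrite -(subrK k%:Z n) xP normcM normc_prod mulrAC.
  by apply: ler_pM; rewrite ?normc_nneg ?prodr_ge0// => i _; exact: normc_nneg.
have cM : (fun k => C * M * mu ^+ k) @ \oo --> C * M * 0.
  by apply: cvgMr; apply: cvg_expr; rewrite gtr0_norm.
rewrite mulr0 in cM.
apply: eq0_normc; apply/eqP; rewrite eq_le normc_nneg andbT.
apply: cvgr_to_ge cM _.
exact: nearW.
Qed.

(* The solution is the limit of the partial sums of
   [sum_k kap (n-1) ... kap (n-k) g (n-k-1)]. *)
Lemma recursion_solution : exists2 K : R, 0 <= K & forall g : ell2 R,
  exists x : ell2 R, (forall n, x (n + 1) = kap n * x n + g n) /\
    ell2_norm x <= K * ell2_norm g.
Proof.
have [C [mu [C0 /andP[mu0 mu1] kC]]] := kap_decay.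
exists (C / (1 - mu)); first by rewrite divr_ge0// subr_ge0 ltW.
move=> g.
(* [P n k] is kap (n-k) ... kap (n-1); [t k] below is the k-th term of the series. *)
pose P (n : int) k := \prod_(i < k) kap (n - k%:Z + i%:Z).
have PC n k : normc (P n k) <= C * mu ^+ k.
  by rewrite normc_prod; exact: kC.
have PS n k : P (n + 1) k.+1 = kap n * P n k.
  rewrite /P big_ord_recr /= mulrC intS; congr (kap _ * _); first by ring.
  by apply: eq_bigr => i _; congr kap; ring.
have /choice[t tP] : forall k, exists x : ell2 R,
    (forall n, x n = P n k * g (n - k%:Z - 1)) /\
    ell2_norm x <= (C * mu ^+ k) * ell2_norm g.
  by move=> k; apply: ell2_mul_reindex => [n|]; [exact: PC | move=> p q; lra].
pose y k : ell2 R := \sum_(i < k) t i.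
have yS k : y k.+1 = y k + t k by rewrite /y big_ord_recr.
pose G := ell2_norm g.
have G0 : 0 <= G by exact: ell2_norm_ge0.
(* The partial sums obey the recursion exactly when the left side has one term more; the discrepancy
   disappears in the limit. *)
have yrec k n : y k.+1 (n + 1) = kap n * y k n + g n.
  elim: k => [|k IH].
    rewrite yS /y big_ord0 add0r ell2_zeroE mulr0 add0r (tP 0%N).1 /P big_ord0.
    by rewrite mul1r; congr (g _); ring.
  rewrite yS ell2_addE IH yS ell2_addE !(tP _).1 PS.
  rewrite (_ : n + 1 - k.+1%:Z - 1 = n - k%:Z - 1); last by rewrite intS; ring.
  by ring.
have yn k : ell2_norm (y k) <= C / (1 - mu) * G.
  have m1 : 0 < 1 - mu by rewrite subr_gt0.
  (* The exact finite geometric sum, with its factor 1 - mu^k, lets the induction close. *)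
  suff : ell2_norm (y k) <= C * G / (1 - mu) * (1 - mu ^+ k).
    move/le_trans; apply; rewrite [X in _ <= X]mulrAC ler_piMr//.
      by rewrite divr_ge0 ?mulr_ge0// ltW.
    by rewrite gerBl exprn_ge0// ltW.
  elim: k => [|k IH].
    rewrite /y big_ord0 expr0 subrr mulr0 -[0 : ell2 R](scale0r (0 : ell2 R)).
    by rewrite ell2_normZ normc0 mul0r.
  rewrite yS; apply: le_trans (ell2_normD _ _) _.
  apply: le_trans (lerD IH (tP k).2) _.
  rewrite exprS le_eqVlt; apply/orP; left; apply/eqP; rewrite -/G; field.
  by rewrite gt_eqF.
(* [h] stands for the real or the imaginary part; the terms are dominated by a geometric series. *)
have cvgpart (h : R[i] -> R) n : (forall z w, h (z + w) = h z + h w) ->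
    (forall z, `|h z| <= normc z) -> cvgn (fun k => h (y k n)).
  move=> hD hle.
  have -> : (fun k => h (y k n)) = series (fun k => h (t k n)).
    apply/funext; elim=> [|k IH].
      rewrite /series /= big_nil /y big_ord0 ell2_zeroE.
      by apply/eqP; rewrite -normr_le0 (le_trans (hle _))// normc0.
    by rewrite yS ell2_addE hD IH /series /= big_nat_recr.
  apply: normed_cvg; apply: (series_le_cvg (v_ := geometric (C * G) mu)).
  - by move=> k; exact: normr_ge0.
  - by move=> k; rewrite /geometric /= mulr_ge0 ?mulr_ge0 ?exprn_ge0// ltW.
  - move=> k; apply: le_trans (hle _) _; apply: le_trans (normc_le_ell2_norm _ _) _.
    by apply: le_trans (tP k).2 _; rewrite /geometric /= mulrAC.
  - by apply: is_cvg_geometric_series; rewrite gtr0_norm.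
have cRe n := cvgpart (@complex.Re R) n (fun z w => raddfD _ z w) (@Re_le_normc R).
have cIm n := cvgpart (@complex.Im R) n (fun z w => raddfD _ z w) (@Im_le_normc R).
pose f n : Cplx R := Complex (limn (fun k => complex.Re (y k n)))
                             (limn (fun k => complex.Im (y k n))).
have [x [xf xn]] := ell2_of_pointwise_limit (f := f) yn cRe cIm.
exists x; split => // n; rewrite !xf.
have ReD (z w : R[i]) : complex.Re (z + w) = complex.Re z + complex.Re w.
  exact: raddfD.
have ImD (z w : R[i]) : complex.Im (z + w) = complex.Im z + complex.Im w.
  exact: raddfD.
have ReM (z w : R[i]) : complex.Re (z * w) =
    complex.Re z * complex.Re w - complex.Im z * complex.Im w.
  by case: z; case: w.
have ImM (z w : R[i]) : complex.Im (z * w) =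
    complex.Re z * complex.Im w + complex.Im z * complex.Re w.
  by case: z; case: w.
apply/eqP; rewrite eq_complex; apply/andP; split; apply/eqP.
- have := cRe (n + 1); rewrite -cvg_shiftS => /(@cvg_unique _ (@Rhausdorff R)).
  apply; rewrite (_ : (fun k => _) = (fun k => complex.Re (kap n) * complex.Re (y k n)
      - complex.Im (kap n) * complex.Im (y k n) + complex.Re (g n))); last first.
    by apply/funext => k; rewrite yrec ReD ReM.
  rewrite [complex.Re (kap n * f n + g n)]ReD ReM.
  by apply: cvgD; [apply: cvgB; apply: cvgMr; [exact: cRe|exact: cIm]|exact: cvg_cst].
- have := cIm (n + 1); rewrite -cvg_shiftS => /(@cvg_unique _ (@Rhausdorff R)).
  apply; rewrite (_ : (fun k => _) = (fun k => complex.Re (kap n) * complex.Im (y k n)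
      + complex.Im (kap n) * complex.Re (y k n) + complex.Im (g n))); last first.
    by apply/funext => k; rewrite yrec ImD ImM.
  rewrite [complex.Im (kap n * f n + g n)]ImD ImM.
  by apply: cvgD; [apply: cvgD; apply: cvgMr; [exact: cIm|exact: cRe]|exact: cvg_cst].
Qed.
End Recursion.

(** * The Jacobi equation in the invariant splitting *)

(* One step of the cocycle [[e, -c], [a, 0]], with multipliers [q] on [s] and
   [p] on [u]; primed variables belong to the next point of the orbit. *)
Section TransferStep.
Variable F : fieldType.
Variables (a c e p q s1 s2 u1 u2 s1' s2' u1' u2' : F).
Hypothesis Bs1 : e * s1 - c * s2 = q * s1'.
Hypothesis Bs2 : a * s1 = q * s2'.
Hypothesis Bu1 : e * u1 - c * u2 = p * u1'.
Hypothesis Bu2 : a * u1 = p * u2'.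
Let D := s1 * u2 - s2 * u1.
Let D' := s1' * u2' - s2' * u1'.

Let pD' : p * D' = s1' * (a * u1) - s2' * (e * u1 - c * u2).
Proof. by rewrite Bu1 Bu2 /D'; ring. Qed.

Let s_parallel : s2' * (e * s1 - c * s2) = s1' * (a * s1).
Proof. by rewrite Bs1 Bs2; ring. Qed.

(** The matrix has determinant a c and takes the basis (s, u) to (q s', p u'). *)
Lemma step_det : a * c * D = q * p * D'.
Proof.
rewrite -[q * p * D']mulrA pD'.
transitivity (q * s1' * (a * u1) - q * s2' * (e * u1 - c * u2)); last by ring.
by rewrite -Bs1 -Bs2 /D; ring.
Qed.

(** With k = c D / (p D') this says k s2' = s1, which is a s1 = q s2' with [a] cancelled. It holds
    also for a = 0: the sides differ by [u1] times the determinant of s' and the image of [s], which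
    vanishes. *)
Lemma step_stable2 : c * D * s2' = s1 * (p * D').
Proof.
apply/eqP; rewrite -subr_eq0 pD'; apply/eqP.
transitivity (u1 * (s2' * (e * s1 - c * s2) - s1' * (a * s1))).
  by rewrite /D; ring.
by rewrite s_parallel subrr mulr0.
Qed.

(** The row e s1 - c s2 = q s1' with [c] cancelled; the sides differ by [u2] times the same
    determinant. *)
Lemma step_stable1 : D * (s2' * e - a * s1') = s2 * (p * D').
Proof.
apply/eqP; rewrite -subr_eq0 pD'; apply/eqP.
transitivity (u2 * (s2' * (e * s1 - c * s2) - s1' * (a * s1))).
  by rewrite /D; ring.
by rewrite s_parallel subrr mulr0.
Qed.

Hypothesis p0 : p != 0.
Hypothesis D0 : D != 0.
Hypothesis D'0 : D' != 0.

Section Inhomogeneous.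
Variables (x x' y y' f : F).
Hypothesis xE : x' = c * D / (p * D') * x + u1 / (p * D') * f.
Hypothesis yE : y = a / p * y' + s2' / (p * D') * f.

(** Compatibility: the second component at the next point is the first component here, so that x s +
    y u can be (psi n, psi (n-1)). *)
Lemma step_shift : x' * s2' + y' * u2' = x * s1 + y * u1.
Proof.
have -> : x' * s2' = x * s1 + u1 * s2' / (p * D') * f.
  have -> : x * s1 = (c * D * s2') / (p * D') * x.
    by rewrite step_stable2; field; rewrite ?p0 ?D'0.
  by rewrite xE; ring.
have -> : y' * u2' = y' * (a * u1) / p by rewrite Bu2; field.
by rewrite yE; ring.
Qed.

(** The terms in [x] cancel since a k = q, those in [y'] by the equation for [y], and the
    coefficients of [f] add up to D' / D'. *)
Lemma step_equation :
  c * (x * s2 + y * u2) + a * (x' * s1' + y' * u1') - e * (x * s1 + y * u1) = f.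
Proof.
transitivity (a * x' * s1' + a * y' * u1'
    - x * (e * s1 - c * s2) - y * (e * u1 - c * u2)); first by ring.
rewrite Bs1 Bu1.
have -> : a * x' = q * x + u2' / D' * f.
  rewrite xE mulrDr; congr (_ + _).
    rewrite (_ : a * _ = a * c * D / (p * D') * x); last by ring.
    by rewrite step_det; field; rewrite ?p0 ?D'0.
  rewrite (_ : a * _ = a * u1 / (p * D') * f); last by ring.
  by rewrite Bu2; field; rewrite ?p0 ?D'0.
rewrite yE /D'; field.
by rewrite p0 D'0.
Qed.

End Inhomogeneous.

Section Homogeneous.
Variables (x y z : F).
Hypothesis xyz : c * x + a * z - e * y = 0.

Let azE : a * z = e * y - c * x.
Proof. by apply/eqP; rewrite -subr_eq0 -[X in _ == X]xyz; apply/eqP; ring. Qed.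

(** Here [x], [y], [z] are psi (n-1), psi n, psi (n+1), so the matrix sends (y, x) to a (z, y). Both
    sides contain coordinates along the stable vector, given by Cramer's rule. *)
Lemma step_stable_coord :
  (z * u2' - y * u1') / D' = c * D / (p * D') * ((y * u2 - x * u1) / D).
Proof.
have -> : z * u2' - y * u1' = c * (y * u2 - x * u1) / p.
  apply: (mulfI p0); transitivity (z * (p * u2') - y * (p * u1')); first by ring.
  rewrite -Bu1 -Bu2 (_ : z * (a * u1) = a * z * u1); last by ring.
  by rewrite azE; field.
by field; rewrite ?p0 ?D0 ?D'0.
Qed.

(** The coordinates along the unstable vector by Cramer's rule; [step_stable1] and [step_stable2]
    avoid dividing by [a] or [c], which may vanish. *)
Lemma step_unstable_coord :
  (s1 * x - s2 * y) / D = a / p * ((s1' * y - s2' * z) / D').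
Proof.
have -> : (s1 * x - s2 * y) =
    (x * (s1 * (p * D')) - y * (s2 * (p * D'))) / (p * D').
  by field; rewrite ?p0 ?D'0.
rewrite -step_stable1 -step_stable2.
have -> : a / p * ((s1' * y - s2' * z) / D') = (a * s1' * y - s2' * (a * z)) / (p * D').
  by field; rewrite ?p0 ?D'0.
by rewrite azE; field; rewrite ?p0 ?D0 ?D'0.
Qed.

End Homogeneous.
End TransferStep.

(** * Solving the Jacobi equation along one orbit *)

Section JacobiEquation.
Variable R : realType.
Variables (A e p q s1 s2 u1 u2 : int -> R[i]) (M d dp : R).
Let D n := s1 n * u2 n - s2 n * u1 n.
Hypothesis Bs1 : forall n, e n * s1 n - (A (n - 1))^* * s2 n = q n * s1 (n + 1).
Hypothesis Bs2 : forall n, A n * s1 n = q n * s2 (n + 1).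
Hypothesis Bu1 : forall n, e n * u1 n - (A (n - 1))^* * u2 n = p n * u1 (n + 1).
Hypothesis Bu2 : forall n, A n * u1 n = p n * u2 (n + 1).
Hypothesis AM : forall n, normc (A n) <= M.
Hypothesis s1_le1 : forall n, normc (s1 n) <= 1.
Hypothesis s2_le1 : forall n, normc (s2 n) <= 1.
Hypothesis u1_le1 : forall n, normc (u1 n) <= 1.
Hypothesis u2_le1 : forall n, normc (u2 n) <= 1.
Hypothesis d0 : 0 < d.
Hypothesis dp0 : 0 < dp.
Hypothesis Dd : forall n, d <= normc (D n).
Hypothesis pdp : forall n, dp <= normc (p n).
Hypothesis qp_decay : geom_decay (fun n => normc (q n) / normc (p n)).

Let p0 n : p n != 0 := normc_neq0 dp0 (pdp n).
Let D0 n : D n != 0 := normc_neq0 d0 (Dd n).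

Let stable_det n := step_det (Bs1 n) (Bs2 n) (Bu1 n) (Bu2 n).

Let D_le2 n : normc (D n) <= 2.
Proof.
apply: le_trans (normc_triangle _ _) _; rewrite normcN !normcM.
have := @mulr_ile1 R _ _ (normc_nneg (s1 n)) (normc_nneg (u2 n)) (s1_le1 n) (u2_le1 n).
have := @mulr_ile1 R _ _ (normc_nneg (s2 n)) (normc_nneg (u1 n)) (s2_le1 n) (u1_le1 n).
lra.
Qed.

(** The multipliers k and r of the decoupled system; by [step_det] their product is q / p. *)
Definition stable_mult n : R[i] := (A (n - 1))^* * D n / (p n * D (n + 1)).
Definition unstable_mult n : R[i] := A n / p n.

Lemma mult_decay : geom_decay (fun n => normc (unstable_mult n)) /\
  geom_decay (fun n => normc (stable_mult n)).
Proof.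
have AM' n : 0 <= normc (A n) <= M by rewrite normc_nneg AM.
have Dd' n : d <= normc (D n) <= 2 by rewrite Dd D_le2.
have [|ru rs] := geom_decay_factors dp0 d0 AM' pdp Dd'.
  rewrite (_ : (fun n => _) = (fun n => normc (q n) / normc (p n)))//.
  apply/funext => n.
  have np : normc (p n) != 0 by rewrite gt_eqF// (lt_le_trans dp0).
  have nD : normc (D (n + 1)) != 0 by rewrite gt_eqF// (lt_le_trans d0).
  rewrite -(normc_conjc (A (n - 1))) -!normcM stable_det !normcM; field.
  by rewrite np nD.
split.
- rewrite (_ : (fun n => _) = (fun n => normc (A n) / normc (p n)))//.
  by apply/funext => n; rewrite normcM normcV.
- rewrite (_ : (fun n => _) = (fun n => normc (A (n - 1)) * normc (D n) /
    (normc (p n) * normc (D (n + 1)))))//.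
  by apply/funext => n; rewrite !normcM normcV normcM normc_conjc.
Qed.

(** With be m = y (-m), the backward relation between y n and y (n + 1) becomes a forward recursion
    whose multiplier at m is r (-1 - m). *)
Let decay_unstable_rev :
  geom_decay (fun n => normc (unstable_mult (-1 - n))) :=
  geom_decay_rev (-1) mult_decay.1.

(** With [e] the values of E - b along an orbit, this is (J - E) psi. *)
Definition jacobi_residual (psi : int -> R[i]) n : R[i] :=
  (A (n - 1))^* * psi (n - 1) + A n * psi (n + 1) - e n * psi n.

Lemma jacobi_residual_solve : exists2 K : R, 0 <= K & forall f : ell2 R,
  exists psi : ell2 R, (forall n, jacobi_residual psi n = f n) /\
    ell2_norm psi <= K * ell2_norm f.
Proof.
have [Ks Ks0 solve_s] := recursion_solution mult_decay.2.
have [Ku Ku0 solve_u] := recursion_solution decay_unstable_rev.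
have dd0 : 0 < dp * d by exact: mulr_gt0.
pose L := (dp * d)^-1.
have L0 : 0 <= L by rewrite invr_ge0 ltW.
have coefL n (z : R[i]) : normc z <= 1 -> normc (z / (p n * D (n + 1))) <= L.
  move=> z1; rewrite normcM normcV normcM -[L]mul1r.
  apply: ler_pM; rewrite ?normc_nneg ?invr_ge0 ?mulr_ge0 ?normc_nneg//.
  rewrite lef_pV2 ?posrE ?mulr_gt0 ?(lt_le_trans d0 (Dd _)) ?(lt_le_trans dp0 (pdp _))//.
  by apply: ler_pM => //; exact: ltW.
exists ((Ks + Ku) * L); first by rewrite mulr_ge0// addr_ge0.
move=> f.
have [gs [gsE gsn]] := @ell2_mul_reindex R L
  (fun n => u1 n / (p n * D (n + 1))) id f (fun n => coefL _ _ (u1_le1 n)) (fun _ _ => id).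
have inj_rev : injective (fun n : int => -1 - n) by move=> m n /addrI/oppr_inj.
have inj_opp : injective (fun n : int => - n) by exact: oppr_inj.
(* The forcing term of the unstable recursion, reflected to match [decay_unstable_rev]. *)
have [gu [guE gun]] := @ell2_mul_reindex R L
  (fun n => s2 (-1 - n + 1) / (p (-1 - n) * D (-1 - n + 1))) _ f
  (fun n => coefL _ _ (s2_le1 _)) inj_rev.
have [al [alE aln]] := solve_s gs.
have [be [beE ben]] := solve_u gu.
have [x [xE xn]] := @ell2_mul_reindex R 1 s1 id al s1_le1 (fun _ _ => id).
have [y [yE yn]] := @ell2_mul_reindex R 1 u1 _ be u1_le1 inj_opp.
exists (x + y).
have alrec n : al (n + 1) = (A (n - 1))^* * D n / (p n * D (n + 1)) * al n
    + u1 n / (p n * D (n + 1)) * f n by rewrite alE gsE.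
have berec n : be (- n) = A n / p n * be (- (n + 1))
    + s2 (n + 1) / (p n * D (n + 1)) * f n.
  rewrite (_ : - n = - (n + 1) + 1); last by ring.
  rewrite beE guE /unstable_mult (_ : -1 - (- (n + 1)) = n)//; last by ring.
have shift n : al (n + 1) * s2 (n + 1) + be (- (n + 1)) * u2 (n + 1)
    = al n * s1 n + be (- n) * u1 n.
  exact: (step_shift (Bs1 n) (Bs2 n) (Bu1 n) (Bu2 n) (p0 n) (D0 (n + 1)) (alrec n) (berec n)).
have psiE n : (x + y) n = al n * s1 n + be (- n) * u1 n.
  by rewrite ell2_addE xE yE [s1 n * _]mulrC [u1 n * _]mulrC.
split.
  (* By [shift], psi (n - 1) becomes the second component at [n], the form that [step_equation]
     expects. *)
  move=> n; rewrite /jacobi_residual !psiE -[in X in X + _ - _](shift (n - 1)) subrK.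
  exact: (step_equation (Bs1 n) (Bs2 n) (Bu1 n) (Bu2 n) (p0 n) (D0 (n + 1)) (alrec n) (berec n)).
apply: le_trans (ell2_normD _ _) _; rewrite -mulrA mulrDl.
rewrite !mul1r in xn yn.
apply: lerD.
  by apply: le_trans xn _; apply: le_trans aln _; rewrite ler_wpM2l.
by apply: le_trans yn _; apply: le_trans ben _; rewrite ler_wpM2l.
Qed.

Lemma jacobi_residual_inj (psi : ell2 R) :
  (forall n, jacobi_residual psi n = 0) -> psi = 0.
Proof.
move=> psi0.
have psiM n := normc_le_ell2_norm psi n.
(* Coordinates in the basis (s, u) inherit boundedness from [psi], as [D] is bounded below;
   [recursion_uniq] then kills them. *)
have coordM n (z w : R[i]) i j : normc z <= 1 -> normc w <= 1 ->
    normc ((z * psi i - w * psi j) / D n) <= 2 * ell2_norm psi / d.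
  move=> z1 w1; rewrite normcM normcV; apply: ler_pM.
  - exact: normc_nneg.
  - by rewrite invr_ge0 normc_nneg.
  - apply: le_trans (normc_triangle _ _) _; rewrite normcN !normcM.
    rewrite mulr_natl mulr2n -[ell2_norm psi]mul1r.
    by apply: lerD; apply: ler_pM; rewrite ?normc_nneg ?mul1r.
  - by rewrite lef_pV2 ?posrE ?(lt_le_trans d0 (Dd _)).
have al0 : forall n, (u2 n * psi n - u1 n * psi (n - 1)) / D n = 0.
  apply: (recursion_uniq mult_decay.2 (fun n => coordM n _ _ _ _ (u2_le1 n) (u1_le1 n))) => n.
  rewrite addrK ![u2 _ * _]mulrC ![u1 _ * _]mulrC.
  exact: (step_stable_coord (Bu1 n) (Bu2 n) (p0 n) (D0 n) (D0 (n + 1)) (psi0 n)).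
have be0 n : (s1 n * psi (n - 1) - s2 n * psi n) / D n = 0.
  rewrite -[n]opprK.
  apply: (recursion_uniq decay_unstable_rev
    (x := fun n => (s1 (- n) * psi (- n - 1) - s2 (- n) * psi (- n)) / D (- n))
    (fun n => coordM (- n) _ _ _ _ (s1_le1 _) (s2_le1 _))) => m.
  rewrite (_ : - (m + 1) = -1 - m); last by ring.
  have := (step_unstable_coord (Bs1 (-1 - m)) (Bs2 (-1 - m)) (Bu1 (-1 - m)) (Bu2 (-1 - m))
    (p0 (-1 - m)) (D0 (-1 - m)) (D0 (-1 - m + 1)) (psi0 (-1 - m))).
  by rewrite (_ : -1 - m + 1 = - m) ?[- m - 1]addrC//; last by ring.
apply: val_inj; apply/funext => n /=.
transitivity (s1 n * ((u2 n * psi n - u1 n * psi (n - 1)) / D n)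
   + u1 n * ((s1 n * psi (n - 1) - s2 n * psi n) / D n)).
  have := D0 n; rewrite /D => Dn.
  by field.
by rewrite al0 be0 !mulr0 addr0.
Qed.

End JacobiEquation.

(** * Continuous functions on the projective line *)

(** Solutions are chosen pointwise; injectivity of [A] makes the choice a linear two-sided inverse,
    and the bound makes it continuous. *)
Lemma boundedly_invertible_of_bound (K : numFieldType) (V : normedModType K)
    (A : V -> V) (C : K) : 0 <= C -> linear A ->
  (forall v, A v = 0 -> v = 0) ->
  (forall f, exists v, A v = f /\ `|v| <= C * `|f|) ->
  boundedly_invertible A.
Proof.
move=> C0 linA injA /choice[S SP].
have AS : cancel S A by move=> f; exact: (SP f).1.
have AB u v : A (u - v) = A u - A v.
  by rewrite -scaleN1r addrC linA scaleN1r addrC.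
have SA : cancel A S.
  by move=> v; apply/eqP; rewrite -subr_eq0; apply/eqP/injA; rewrite AB AS subrr.
have linS : linear S.
  by move=> c u v; apply: (can_inj SA); rewrite linA !AS.
pose Sl : {linear V -> V} := HB.pack S (GRing.isLinear.Build K V V *:%R S linS).
exists Sl; split => //.
apply/bounded_linear_continuous/linear_boundedP.
exists C; split; first exact: ger0_real.
move=> r Cr x; apply: le_trans (SP x).2 _.
by rewrite ler_wpM2r// ltW.
Qed.

Lemma cts_comp (X Y Z : topologicalType) (f : X -> Y) (g : Y -> Z) :
  continuous f -> continuous g -> continuous (fun x => g (f x)).
Proof. by move=> cf cg x; apply: continuous_comp; [exact: cf|exact: cg]. Qed.

Section RealContinuous.
Variables (R : realType) (X : topologicalType).
Implicit Types f g : X -> R.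

Lemma cts_cst (c : R) : continuous (fun _ : X => c).
Proof. by move=> x; exact: cvg_cst. Qed.

Lemma ctsD f g : continuous f -> continuous g -> continuous (fun x => f x + g x).
Proof. by move=> cf cg x; apply: cvgD; [exact: cf|exact: cg]. Qed.

Lemma ctsN f : continuous f -> continuous (fun x => - f x).
Proof. by move=> cf x; apply: cvgN; exact: cf. Qed.

Lemma ctsM f g : continuous f -> continuous g -> continuous (fun x => f x * g x).
Proof. by move=> cf cg x; apply: cvgM; [exact: cf|exact: cg]. Qed.

Lemma ctsV f : (forall x, f x != 0) -> continuous f ->
  continuous (fun x => (f x)^-1).
Proof. by move=> f0 cf x; apply: cvgV => //; exact: cf. Qed.

Lemma ctsX f : continuous f -> continuous (fun x => f x ^+ 2).
Proof. by move=> cf; exact: ctsM. Qed.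

End RealContinuous.

(** The reciprocal of [h] is continuous, hence bounded above. *)
Lemma compact_pos_lower_bound (R : realType) (X : topologicalType) (h : X -> R) :
  compact [set: X] -> continuous h -> (forall x, 0 < h x) ->
  exists2 d : R, 0 < d & forall x, d <= h x.
Proof.
move=> cX ch h0.
have [|M hM] := @compact_norm_bounded R X (fun x => (h x)^-1) cX.
  by apply: ctsV => // x; rewrite gt_eqF.
have M0 : 0 < `|M| + 1 by rewrite ltr_pwDr.
exists (`|M| + 1)^-1; first by rewrite invr_gt0.
move=> x; rewrite -[h x]invrK lef_pV2 ?posrE ?invr_gt0//.
apply: le_trans (ler_norm _) _; apply: le_trans (hM x) _.
by apply: le_trans (ler_norm M) _; rewrite lerDl.
Qed.

(** * A continuity criterion at infinity *)

Section ProjectiveLine.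
Variable R : realType.

Lemma normc_lipschitz_continuous (h : R[i] -> R) :
  (forall z w, `|h z - h w| <= normc (z - w)) -> continuous (h : Cplx R -> R).
Proof.
move=> hL z; apply/(@cvgrPdist_lt _ _ _ (nbhs z) (nbhs_filter z)) => e e0.
have : \forall w \near z, `|z - w| < e%:C%C.
  by apply/nbhs_ballP; exists e%:C%C => //=; rewrite ltcR.
by apply: filterS => w; rewrite -Defs.normcE ltcR; apply: le_lt_trans.
Qed.

Lemma Re_continuous : continuous (@complex.Re R : Cplx R -> R).
Proof.
by apply: normc_lipschitz_continuous => z w; rewrite -raddfB Re_le_normc.
Qed.

Lemma Im_continuous : continuous (@complex.Im R : Cplx R -> R).
Proof.
by apply: normc_lipschitz_continuous => z w; rewrite -raddfB Im_le_normc.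
Qed.

Lemma complex_pair_continuous :
  continuous (fun xy : R * R => Complex xy.1 xy.2 : Cplx R).
Proof.
move=> xy; apply/(@cvgrPdist_lt _ _ _ (nbhs xy) (nbhs_filter xy)) => e e0.
have /andP[Re0 /eqP Im0] : (0 < complex.Re e) && (complex.Im e == 0).
  by move: e0; case: e => er ei; rewrite ltcE /= => /andP[/eqP -> ->]; rewrite eqxx.
have -> : e = (complex.Re e)%:C%C by apply/eqP; rewrite eq_complex /= Im0 !eqxx.
have e20 : 0 < complex.Re e / 2 by rewrite divr_gt0.
near=> w; rewrite -Defs.normcE ltcR.
apply: le_lt_trans (normc_le_ReIm _) _.
rewrite [X in _ < X](splitr (complex.Re e)) /=; apply: ltrD.
- near: w; move: (complex.Re e / 2) e20; apply/(@cvgrPdist_lt _ _ _ _ (nbhs_filter xy)).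
  exact: cvg_fst.
- near: w; move: (complex.Re e / 2) e20; apply/(@cvgrPdist_lt _ _ _ _ (nbhs_filter xy)).
  exact: cvg_snd.
Unshelve. all: by end_near. Qed.

Lemma compact_square (K : R) : compact
  [set z : Cplx R | `|complex.Re z| <= K /\ `|complex.Im z| <= K].
Proof.
have cK := @segment_compact R (- K) K.
rewrite (_ : [set z | _] = (fun xy : R * R => Complex xy.1 xy.2 : Cplx R) @`
    (`[- K, K] `*` `[- K, K])).
  apply: continuous_compact; last exact: compact_setX.
  by apply: continuous_subspaceT; exact: complex_pair_continuous.
apply/seteqP; split => [[x y] /= [xK yK]|_ [[x y] [/= xK yK] <-] /=].
  by exists (x, y) => //=; rewrite !in_itv /= -!ler_norml.
by move: xK yK; rewrite !in_itv /= -!ler_norml.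
Qed.

(** Complements of closed compact sets, here of the squares in [compact_square], are neighbourhoods
    of infinity; the last hypothesis makes [f] small there. *)
Lemma CP1_continuous (f : CP1 R -> R) : f None = 0 ->
  continuous (fun z : Cplx R => f (Some z)) ->
  (forall (z : Cplx R) (K : R), 0 < K ->
     K < `|complex.Re z| \/ K < `|complex.Im z| -> `|f (Some z)| <= K^-1) ->
  continuous f.
Proof.
move=> f0 cf fK [z|]; first exact: cf.
apply/(@cvgrPdist_le _ _ _ _ (nbhs_filter (None : CP1 R))) => e e0.
rewrite f0; exists [set z : Cplx R | `|complex.Re z| <= e^-1 /\ `|complex.Im z| <= e^-1].
  have ck := @compact_square (e^-1); split => //.
  by apply: compact_closed => //; exact: norm_hausdorff.
move=> p [[z nz <-]|->] /=; last by rewrite f0 subrr normr0 ltW.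
rewrite sub0r normrN -[e]invrK; apply: fK; first by rewrite invr_gt0.
have [zr|] := leP `|complex.Re z| e^-1; last by left.
have [zi|] := leP `|complex.Im z| e^-1; last by right.
by exfalso; apply: nz.
Qed.

End ProjectiveLine.

(** * Unit vectors on lines and their phase-independent invariants *)

Section UnitSection.
Variable R : realType.
Implicit Types P Q : CP1 R.

Definition unit_scale (z : R[i]) : R := (Num.sqrt (1 + normc z ^+ 2))^-1.

Definition unit1 P : R[i] := if P is Some z then (unit_scale z)%:C%C else 0.
Definition unit2 P : R[i] := if P is Some z then z * (unit_scale z)%:C%C else 1.
Definition unitv P : 'cV[Cplx R]_2 :=
  \col_(i < 2) (if i == 0 then unit1 P else unit2 P).

(* [weight P] is |u_1|^2 and [crossRe P], [crossIm P] are the real and imaginary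
   parts of conj(u_1) u_2, for [u = unitv P].  Unlike [unitv], which jumps in
   phase at infinity, these are continuous on CP^1. *)
Definition weight P : R :=
  if P is Some z then (1 + normc z ^+ 2)^-1 else 0.
Definition crossRe P : R :=
  if P is Some z then complex.Re z * (1 + normc z ^+ 2)^-1 else 0.
Definition crossIm P : R :=
  if P is Some z then complex.Im z * (1 + normc z ^+ 2)^-1 else 0.

Lemma one_normc_sqr_gt0 (z : R[i]) : 0 < 1 + normc z ^+ 2.
Proof. by rewrite ltr_pwDl// sqr_ge0. Qed.

Lemma unit_scale_sqr z : unit_scale z ^+ 2 = (1 + normc z ^+ 2)^-1.
Proof. by rewrite exprVn sqr_sqrtr// ltW// one_normc_sqr_gt0. Qed.

Lemma unit_scale_neq0 z : unit_scale z != 0.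
Proof.
by rewrite -sqrf_eq0 unit_scale_sqr invr_eq0 gt_eqF// one_normc_sqr_gt0.
Qed.

Lemma weight_compl z : 1 - weight (Some z) = unit_scale z ^+ 2 * normc z ^+ 2.
Proof.
rewrite unit_scale_sqr /=; field; rewrite gt_eqF// one_normc_sqr_gt0//.
Qed.

(** The cross term is 2 Re (conj(al) be conj(u_1) u_2). The squared modulus thus depends only on the
    line, through functions continuous on CP^1. *)
Lemma normc_comb (al be : R[i]) P :
  normc (al * unit1 P + be * unit2 P) ^+ 2 =
    normc al ^+ 2 * weight P + normc be ^+ 2 * (1 - weight P)
    + 2 * ((complex.Re al * complex.Re be + complex.Im al * complex.Im be) * crossRe P
           - (complex.Re al * complex.Im be - complex.Im al * complex.Re be) * crossIm P).
Proof.
case: P => [z|]; last first.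
  by rewrite /= mulr0 mulr1 add0r subr0 !mulr0 subrr !mulr0 add0r addr0 mulr1.
rewrite weight_compl /= -unit_scale_sqr; move: (unit_scale z) => k.
rewrite !normc_sqr; case: al be z => [ar ai] [br bi] [x y] /=; ring.
Qed.

Lemma normc_unit1 P : normc (unit1 P) ^+ 2 = weight P.
Proof.
have := normc_comb 1 0 P; rewrite mul1r mul0r addr0 => ->.
by rewrite !normc_sqr /=; ring.
Qed.

Lemma normc_unit2 P : normc (unit2 P) ^+ 2 = 1 - weight P.
Proof.
have := normc_comb 0 1 P; rewrite mul1r mul0r add0r => ->.
by rewrite !normc_sqr /=; ring.
Qed.

Lemma weight_ge0 P : 0 <= weight P.
Proof. by rewrite -normc_unit1 sqr_ge0. Qed.

Lemma weight_le1 P : weight P <= 1.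
Proof. by rewrite -subr_ge0 -normc_unit2 sqr_ge0. Qed.

Lemma normc_unit1_le1 P : normc (unit1 P) <= 1.
Proof.
by rewrite -(@expr_le1 _ 2)// ?normc_nneg// normc_unit1 weight_le1.
Qed.

Lemma normc_unit2_le1 P : normc (unit2 P) <= 1.
Proof.
by rewrite -(@expr_le1 _ 2)// ?normc_nneg// normc_unit2 gerBl weight_ge0.
Qed.

(** The analogous expansion for the determinant of two unit vectors. *)
Lemma normc_unit_det P Q :
  normc (unit1 P * unit2 Q - unit2 P * unit1 Q) ^+ 2 =
    weight P * (1 - weight Q) + (1 - weight P) * weight Q
    - 2 * (crossRe P * crossRe Q + crossIm P * crossIm Q).
Proof.
case: P => [z|]; last first.
  by rewrite /= mul0r add0r normcN mul1r normc_unit1; ring.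
case: Q => [z'|]; last first.
  by rewrite [unit1 None]/= [unit2 None]/= mulr1 mulr0 subr0 normc_unit1 /=; ring.
rewrite !weight_compl /= -!unit_scale_sqr.
move: (unit_scale z) (unit_scale z') => k k'.
rewrite !normc_sqr; case: z z' => [x y] [x' y'] /=; ring.
Qed.

Lemma unit_det_neq0 P Q : P <> Q ->
  unit1 P * unit2 Q - unit2 P * unit1 Q != 0.
Proof.
have k0 z : (unit_scale z)%:C%C != 0.
  by rewrite -(rmorph0 (real_complex R)) (inj_eq (fmorph_inj _)) unit_scale_neq0.
case: P Q => [z|] [z'|] //= PQ.
- rewrite (_ : _ - _ = (unit_scale z)%:C%C * (unit_scale z')%:C%C * (z' - z)); last by ring.
  rewrite !mulf_neq0// subr_eq0; apply/eqP => zz; apply: PQ; by rewrite zz.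
- by rewrite mulr1 mulr0 subr0.
- by rewrite mul0r mul1r add0r oppr_eq0.
Qed.

(** The estimates at infinity for [CP1_continuous]: K |x| is at most x^2 or |x| |y|, hence at most
    x^2 + y^2. *)
Lemma cross_bound (x y K : R) : 0 < K -> K < `|x| \/ K < `|y| ->
  [/\ (1 + (x ^+ 2 + y ^+ 2))^-1 <= K^-1,
      `|x| * (1 + (x ^+ 2 + y ^+ 2))^-1 <= K^-1 &
      `|y| * (1 + (x ^+ 2 + y ^+ 2))^-1 <= K^-1].
Proof.
move=> K0 Kxy; rewrite -(real_normK (num_real x)) -(real_normK (num_real y)).
have := normr_ge0 x; have := normr_ge0 y.
move: `|x| `|y| Kxy => {x y} x y Kxy y0 x0.
have S0 : 0 < 1 + (x ^+ 2 + y ^+ 2) by rewrite ltr_pwDl// addr_ge0 ?sqr_ge0.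
have Kx : K * x <= x ^+ 2 + y ^+ 2.
  have xy := sqr_ge0 (x - y); case: Kxy => /ltW /(ler_wpM2r x0); nra.
have Ky : K * y <= x ^+ 2 + y ^+ 2.
  have xy := sqr_ge0 (x - y); case: Kxy => /ltW /(ler_wpM2r y0); nra.
have K1 : K <= x ^+ 2 + y ^+ 2 + 1.
  have x1 := sqr_ge0 (x - 1); have y1 := sqr_ge0 (y - 1); case: Kxy; nra.
split.
- by rewrite lef_pV2 ?posrE// addrC.
- by rewrite ler_pdivrMr// mulrC ler_pdivlMr// mulrC (le_trans Kx)// lerDr.
- by rewrite ler_pdivrMr// mulrC ler_pdivlMr// mulrC (le_trans Ky)// lerDr.
Qed.

Lemma inv_sqr_continuous :
  continuous (fun z : Cplx R => (1 + normc z ^+ 2)^-1 : R).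
Proof.
apply: ctsV => [z|]; first by rewrite gt_eqF// one_normc_sqr_gt0.
apply: ctsD; first exact: cts_cst.
by apply: ctsM; exact: normc_continuous.
Qed.

Lemma weight_continuous : continuous weight.
Proof.
apply: CP1_continuous => //; first exact: inv_sqr_continuous.
move=> z K K0 /(cross_bound K0)[h _ _]; rewrite /= normc_sqr ger0_norm//.
by rewrite -normc_sqr invr_ge0 ltW// one_normc_sqr_gt0.
Qed.

Lemma crossRe_continuous : continuous crossRe.
Proof.
apply: CP1_continuous => //.
  by apply: ctsM; [exact: Re_continuous|exact: inv_sqr_continuous].
move=> z K K0 /(cross_bound K0)[_ h _]; rewrite /= normc_sqr normrM.
by rewrite [X in _ * X]ger0_norm// -normc_sqr invr_ge0 ltW// one_normc_sqr_gt0.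
Qed.

Lemma crossIm_continuous : continuous crossIm.
Proof.
apply: CP1_continuous => //.
  by apply: ctsM; [exact: Im_continuous|exact: inv_sqr_continuous].
move=> z K K0 /(cross_bound K0)[_ _ h]; rewrite /= normc_sqr normrM.
by rewrite [X in _ * X]ger0_norm// -normc_sqr invr_ge0 ltW// one_normc_sqr_gt0.
Qed.

Lemma line_unitv P : line P (unitv P).
Proof.
case: P => [z|].
- exists (unit_scale z)%:C%C => //; apply/matrixP => i j; rewrite !mxE.
  by case: ifP => _; rewrite ?mulr1// mulrC.
- by exists 1 => //; apply/matrixP => i j; rewrite !mxE mul1r.
Qed.

Lemma line_unitvP P v : line P v -> exists c : R[i], v = c *: unitv P.
Proof.
move=> [c _ <-]; case: P => [z|].
- have k0 : (unit_scale z)%:C%C != 0.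
    by rewrite -(rmorph0 (real_complex R)) (inj_eq (fmorph_inj _)) unit_scale_neq0.
  exists (c / (unit_scale z)%:C%C); apply/matrixP => i j; rewrite !mxE /=.
  case: ifP => _; first by rewrite divfK// mulr1.
  by rewrite mulrCA divfK// mulrC.
- by exists c; apply/matrixP => i j; rewrite !mxE.
Qed.

Lemma euclid_norm_unitv (c : R[i]) P : euclid_norm (c *: unitv P) = normc c.
Proof.
rewrite /euclid_norm !big_ord_recl big_ord0 !mxE /= !normcM addr0.
rewrite !exprMn normc_unit1 normc_unit2 -mulrDr addrC subrK mulr1.
by rewrite sqrtr_sqr ger0_norm// normc_nneg.
Qed.

End UnitSection.

(** * Dominated splittings of Jacobi cocycles *)

Section InvariantLine.
Variables (R : realType) (Omega : Type) (T Tinv : Omega -> Omega).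
Variables (a : Omega -> Cplx R) (b : Omega -> R) (E : Cplx R).
Variable P : Omega -> CP1 R.
Let B := jacobi_cocycle Tinv a b E.
Hypothesis BP : forall w,
  [set B w *m v | v in line (P w)] `<=` line (P (T w)).

Lemma multiplier_exists :
  exists p : Omega -> R[i], forall w, B w *m unitv (P w) = p w *: unitv (P (T w)).
Proof.
suff /choice[p pP] : forall w, exists c : R[i],
    B w *m unitv (P w) = c *: unitv (P (T w)) by exists p.
by move=> w; apply/line_unitvP/BP; exists (unitv (P w)) => //; exact: line_unitv.
Qed.

Variable p : Omega -> R[i].
Hypothesis pP : forall w, B w *m unitv (P w) = p w *: unitv (P (T w)).

Lemma multiplier1 w : (E - (b w)%:C%C) * unit1 (P w)
  - (a (Tinv w))^*%C * unit2 (P w) = p w * unit1 (P (T w)).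
Proof.
have /matrixP/(_ 0 0) := pP w; rewrite !mxE !big_ord_recl big_ord0 !mxE /= addr0.
by rewrite mulNr.
Qed.

Lemma multiplier2 w : a w * unit1 (P w) = p w * unit2 (P (T w)).
Proof.
have /matrixP/(_ 1 0) := pP w; rewrite !mxE !big_ord_recl big_ord0 !mxE /=.
by rewrite mul0r !addr0.
Qed.

Lemma cocycle_iter_unitv n w : cocycle_iter T B n w *m unitv (P w) =
  (\prod_(i < n) p (iter i T w)) *: unitv (P (iter n T w)).
Proof.
elim: n => [|n IH]; first by rewrite big_ord0 scale1r mul1mx.
by rewrite /= -mulmxA IH -scalemxAr pP scalerA big_ord_recr.
Qed.

Lemma euclid_norm_cocycle_iter n w :
  euclid_norm (cocycle_iter T B n w *m unitv (P w)) =
  \prod_(i < n) normc (p (iter i T w)).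
Proof. by rewrite cocycle_iter_unitv euclid_norm_unitv normc_prod. Qed.

(** As [unitv] has norm 1, |p|^2 is the squared norm of its image. The term [0 * unit2 (P w)] gives
    the second row the shape required by [normc_comb]. *)
Lemma normc_multiplier_sqr w : normc (p w) ^+ 2 =
  normc ((E - (b w)%:C%C) * unit1 (P w) + (- (a (Tinv w))^*%C) * unit2 (P w)) ^+ 2
  + normc (a w * unit1 (P w) + 0 * unit2 (P w)) ^+ 2.
Proof.
rewrite mulNr multiplier1 mul0r addr0 multiplier2 !normcM !exprMn -mulrDr.
by rewrite normc_unit1 normc_unit2 addrC subrK mulr1.
Qed.

End InvariantLine.

(** * Two-sided iterates of the homeomorphism *)

Section Orbit.
Variables (X : Type) (T Tinv : X -> X).
Hypotheses (TK : cancel T Tinv) (TinvK : cancel Tinv T).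

Lemma iterzS n w : iterz T Tinv (n + 1) w = T (iterz T Tinv n w).
Proof.
case: n => [n|[|n]]; first by rewrite -PoszD addn1.
  by rewrite /= TinvK.
rewrite (_ : Negz n.+1 + 1 = Negz n); last by rewrite !NegzE; lra.
by rewrite /= TinvK.
Qed.

Lemma iterzB1 n w : iterz T Tinv (n - 1) w = Tinv (iterz T Tinv n w).
Proof. by rewrite -[in RHS](subrK 1 n) iterzS TK. Qed.

Lemma iterzD n (k : nat) w : iterz T Tinv (n + k%:Z) w = iter k T (iterz T Tinv n w).
Proof.
elim: k => [|k IH]; first by rewrite addr0.
by rewrite intS (addrC 1) addrA iterzS IH.
Qed.

End Orbit.

Section ContinuousLine.
Variables (R : realType) (Omega : topologicalType) (T Tinv : Omega -> Omega).
Hypothesis cTinv : continuous Tinv.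
Variables (a : Omega -> Cplx R) (b : Omega -> R) (E : Cplx R).
Hypotheses (ca : continuous a) (cb : continuous b).
Variable P : Omega -> CP1 R.
Hypothesis cP : continuous P.
Let B := jacobi_cocycle Tinv a b E.
Variable p : Omega -> R[i].
Hypothesis pP : forall w, B w *m unitv (P w) = p w *: unitv (P (T w)).

(** [p] may jump in phase together with [unitv]; its squared modulus is a polynomial in continuous
    functions. *)
Lemma multiplier_continuous : continuous (fun w => normc (p w) ^+ 2).
Proof.
have cRa : continuous (fun w => complex.Re (a w)).
  exact: (cts_comp ca (@Re_continuous R)).
have cIa : continuous (fun w => complex.Im (a w)).
  exact: (cts_comp ca (@Im_continuous R)).
have cRa' : continuous (fun w => complex.Re (a (Tinv w))).
  exact: (cts_comp cTinv cRa).
have cIa' : continuous (fun w => complex.Im (a (Tinv w))).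
  exact: (cts_comp cTinv cIa).
have cW : continuous (fun w => weight (P w)).
  exact: (cts_comp cP (@weight_continuous R)).
have cRe : continuous (fun w => crossRe (P w)).
  exact: (cts_comp cP (@crossRe_continuous R)).
have cIm : continuous (fun w => crossIm (P w)).
  exact: (cts_comp cP (@crossIm_continuous R)).
rewrite (_ : (fun w => _) = (fun w =>
   ((complex.Re E - b w) ^+ 2 + complex.Im E ^+ 2) * weight (P w)
   + (complex.Re (a (Tinv w)) ^+ 2 + complex.Im (a (Tinv w)) ^+ 2) * (1 - weight (P w))
   + 2 * ((- ((complex.Re E - b w) * complex.Re (a (Tinv w)))
            + complex.Im E * complex.Im (a (Tinv w))) * crossRe (P w)
        - ((complex.Re E - b w) * complex.Im (a (Tinv w))
            + complex.Im E * complex.Re (a (Tinv w))) * crossIm (P w))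
   + (complex.Re (a w) ^+ 2 + complex.Im (a w) ^+ 2) * weight (P w))); last first.
  apply/funext => w; rewrite (normc_multiplier_sqr pP) !normc_comb !normc_sqr.
  case: E (a w) (a (Tinv w)) => [er ei] [xr xi] [yr yi] /=; ring.
by repeat first [apply: ctsD | apply: ctsN | apply: ctsM | apply: ctsX
  | exact: cts_cst | assumption].
Qed.

End ContinuousLine.

Lemma unit_det_continuous (R : realType) (Omega : topologicalType)
    (P Q : Omega -> CP1 R) : continuous P -> continuous Q ->
  continuous (fun w => normc (unit1 (P w) * unit2 (Q w)
                              - unit2 (P w) * unit1 (Q w)) ^+ 2).
Proof.
move=> cP cQ; under eq_fun do rewrite normc_unit_det.
have cWP := cts_comp cP (@weight_continuous R).
have cRP := cts_comp cP (@crossRe_continuous R).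
have cIP := cts_comp cP (@crossIm_continuous R).
have cWQ := cts_comp cQ (@weight_continuous R).
have cRQ := cts_comp cQ (@crossRe_continuous R).
have cIQ := cts_comp cQ (@crossIm_continuous R).
by repeat first [apply: ctsD | apply: ctsN | apply: ctsM | exact: cts_cst | assumption].
Qed.

(** * From dominated splitting to bounded invertibility of J - E *)

Theorem corollary2 (R : realType) (Omega : metricType R)
    (cO : compact [set: Omega])
    (T Tinv : Omega -> Omega) (TK : cancel T Tinv) (TinvK : cancel Tinv T)
    (cT : continuous T) (cTinv : continuous Tinv)
    (a : Omega -> Cplx R) (ca : continuous a)
    (b : Omega -> R) (cb : continuous b)
    (E : Cplx R) :
  dominated_splitting T (jacobi_cocycle Tinv a b E) ->
  (\bigcap_(w in [set: Omega])
     resolvent_set (jacobi_op T Tinv cO ca cb w)) E.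
Proof.
move=> [Es [Eu [[cEs cEu] BE [N [lam [N0 lam1 dom]]]]]].
have [q qP] := multiplier_exists (fun w => (BE w).1).
have [p pP] := multiplier_exists (fun w => (BE w).2).
have lam0 : 0 < lam by rewrite (lt_trans ltr01).
have domE w : lam * \prod_(i < N) normc (q (iter i T w)) <
    \prod_(i < N) normc (p (iter i T w)).
  rewrite -(euclid_norm_cocycle_iter qP) -(euclid_norm_cocycle_iter pP).
  apply: dom; rewrite ?line_unitv//; try exact: line_unitv.
  - by rewrite -[unitv _]scale1r euclid_norm_unitv -[1]/(1%:C%C) normc_real normr1.
  - by rewrite -[unitv _]scale1r euclid_norm_unitv -[1]/(1%:C%C) normc_real normr1.
have prodq_ge0 w : 0 <= \prod_(i < N) normc (q (iter i T w)).
  by apply: prodr_ge0 => i _; exact: normc_nneg.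
(* A zero of [p] would annihilate the right side of [domE], contradicting the strict inequality. *)
have p_gt0 w : 0 < normc (p w) ^+ 2.
  rewrite exprn_gt0// lt_neqAle normc_nneg andbT eq_sym; apply/eqP => pw0.
  have := domE w; rewrite ltNge => /negP; apply.
  rewrite (bigD1 (Ordinal N0))//= pw0 mul0r mulr_ge0// ltW//.
(* On a common line, domination would compare one vector with itself, impossible for [lam] > 1. *)
have EsEu w : Es w <> Eu w.
  move=> EE; have := dom w (unitv (Eu w)) (unitv (Es w)) (line_unitv _) (line_unitv _).
  rewrite EE -[unitv _]scale1r euclid_norm_unitv -[1]/(1%:C%C) normc_real normr1.
  rewrite scale1r => /(_ erefl erefl); rewrite (euclid_norm_cocycle_iter pP).
  rewrite ltNge ler_peMl ?(ltW lam1)//.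
  by apply: prodr_ge0 => i _; exact: normc_nneg.
have D_gt0 w : 0 < normc (unit1 (Es w) * unit2 (Eu w) - unit2 (Es w) * unit1 (Eu w)) ^+ 2.
  rewrite exprn_gt0// lt_neqAle normc_nneg andbT eq_sym.
  by apply: contra (unit_det_neq0 (EsEu w)) => /eqP/eq0_normc/eqP.
have [dp dp0 dpP] := compact_pos_lower_bound cO (multiplier_continuous cTinv ca cb cEu pP) p_gt0.
have [d d0 dP] := compact_pos_lower_bound cO (unit_det_continuous cEs cEu) D_gt0.
have [Kq KqP] := compact_norm_bounded cO (multiplier_continuous cTinv ca cb cEs qP).
have [M aM] := compact_normc_bounded cO ca.
have {}dp0 : 0 < Num.sqrt dp by rewrite sqrtr_gt0.
have {}d0 : 0 < Num.sqrt d by rewrite sqrtr_gt0.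
have {}dpP w := normc_ge_sqrt (dpP w).
have {}dP w := normc_ge_sqrt (dP w).
(* From 2 |q| <= |q|^2 + 1. *)
have qK w : normc (q w) <= 1 + Kq.
  have := le_trans (ler_norm _) (KqP w); have := sqr_ge0 (normc (q w) - 1).
  by have := normc_nneg (q w); nra.
move=> w _; pose W n := iterz T Tinv n w.
have WS n : W (n + 1) = T (W n) by exact: iterzS.
have WB n : W (n - 1) = Tinv (W n) by exact: iterzB1.
(* By [domE] every block of length [N] has product at most 1 / [lam]. *)
have qp_decay : geom_decay (fun n => normc (q (W n)) / normc (p (W n))).
  apply: (block_geom_decay (K := (1 + Kq) / Num.sqrt dp) (theta := lam^-1) N0).
  - by rewrite invr_gt0 lam0 invf_lt1.
  - move=> n; rewrite divr_ge0 ?normc_nneg//=.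
    apply: ler_pM; rewrite ?invr_ge0 ?normc_nneg//.
    by rewrite lef_pV2 ?posrE ?(lt_le_trans dp0 (dpP _)).
  - move=> m; rewrite prodf_div.
    have pr0 : 0 < \prod_(i < N) normc (p (W (m + i%:Z))).
      by apply: prodr_gt0 => i _; exact: lt_le_trans dp0 (dpP _).
    rewrite ler_pdivrMr// ler_pdivlMl//.
    have := ltW (domE (W m)).
    rewrite (eq_bigr (fun i : 'I_N => normc (q (W (m + i%:Z))))); last first.
      by move=> i _; rewrite /W iterzD.
    rewrite [X in _ <= X](eq_bigr (fun i : 'I_N => normc (p (W (m + i%:Z)))))//.
    by move=> i _; rewrite /W iterzD.
have Bs1 n : (E - (b (W n))%:C%C) * unit1 (Es (W n)) - (a (W (n - 1)))^*%C * unit2 (Es (W n))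
    = q (W n) * unit1 (Es (W (n + 1))).
  by rewrite WB WS (multiplier1 qP).
have Bs2 n : a (W n) * unit1 (Es (W n)) = q (W n) * unit2 (Es (W (n + 1))).
  by rewrite WS (multiplier2 qP).
have Bu1 n : (E - (b (W n))%:C%C) * unit1 (Eu (W n)) - (a (W (n - 1)))^*%C * unit2 (Eu (W n))
    = p (W n) * unit1 (Eu (W (n + 1))).
  by rewrite WB WS (multiplier1 pP).
have Bu2 n : a (W n) * unit1 (Eu (W n)) = p (W n) * unit2 (Eu (W (n + 1))).
  by rewrite WS (multiplier2 pP).
have [K K0 solve] := jacobi_residual_solve Bs1 Bs2 Bu1 Bu2
  (fun n => aM (W n)) (fun n => normc_unit1_le1 (Es (W n)))
  (fun n => normc_unit2_le1 (Es (W n))) (fun n => normc_unit1_le1 (Eu (W n)))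
  (fun n => normc_unit2_le1 (Eu (W n))) d0 dp0 (fun n => dP (W n)) (fun n => dpP (W n)) qp_decay.
have inj := jacobi_residual_inj Bs1 Bs2 Bu1 Bu2
  (fun n => aM (W n)) (fun n => normc_unit1_le1 (Es (W n)))
  (fun n => normc_unit2_le1 (Es (W n))) (fun n => normc_unit1_le1 (Eu (W n)))
  (fun n => normc_unit2_le1 (Eu (W n))) d0 dp0 (fun n => dP (W n)) (fun n => dpP (W n)) qp_decay.
set J := jacobi_op T Tinv cO ca cb w.
have JE psi n : (J psi - E *: psi) n = jacobi_residual (fun n => a (W n))
    (fun n => E - (b (W n))%:C%C) psi n.
  rewrite /jacobi_residual.
  have regroup (x y z A B c e : R[i]) :
    A * x + B * y + c * z - e * z = A * x + B * y - (e - c) * z by ring.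
  exact: regroup.
(* Membership in the resolvent set is a double negation, so it suffices to prove bounded
   invertibility. *)
move=> nb; apply: nb.
apply: (boundedly_invertible_of_bound (C := K%:C%C)).
- by rewrite lecR.
- move=> c u v; apply: val_inj; apply/funext => n.
  have cE (x y : ell2 R) : (c *: x + y) n = c * x n + y n by [].
  change ((J (c *: u + v) - E *: (c *: u + v)) n =
    (c *: (J u - E *: u) + (J v - E *: v)) n).
  rewrite cE !JE /jacobi_residual.
  have expand (x y z x' y' z' A B e : R[i]) :
    A * (c * x + x') + B * (c * y + y') - e * (c * z + z') =
    c * (A * x + B * y - e * z) + (A * x' + B * y' - e * z') by ring.
  exact: expand.
- by move=> v v0; apply: inj => n; rewrite -JE v0.
- move=> f; have [psi [psiE psin]] := solve f; exists psi; split.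
    by apply: val_inj; apply/funext => n; exact: etrans (JE _ _) (psiE _).
  by rewrite /Num.norm /= /ell2_normC -rmorphM lecR.
Qed.
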